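(* Let $\Sigma$ be a Lefschetz fan of dimension $d$, and $\ell_2,\ell_3,\ldots,\ell_d$ elements in the closure of $\mathscr K(\Sigma)$. Then for any $\ell_1\in A^1(\Sigma)$, \[ \deg(\ell_1\ell_2\cdots \ell_d)^2\geq \deg(\ell_1\ell_1\ell_3\cdots \ell_d)\cdot \deg(\ell_2\ell_2\ell_3\cdots \ell_d). \]
   Context: $\Sigma$ is a rational simplicial fan in $\mathrm N=\mathbb R\otimes\mathrm N_{\mathbb Z}$ with Chow ring $A(\Sigma)$ (piecewise polynomials modulo global linear functions). For a cone $\sigma$, $\mathrm{st}_\Sigma(\sigma)$ is the fan in $\mathrm N/\mathrm{span}(\sigma)$ of images of cones containing $\sigma$, with restriction $\iota_\sigma^*$. $\mathscr K(\Sigma)\subseteq A^1(\Sigma)$ is the cone of classes $\ell$ such that for every cone $\sigma$ (including $\{0\}$), $\iota_\sigma^*\ell$ has a representative positive on the nonzero support of $\mathrm{st}_\Sigma(\sigma)$. Lefschetz: $d$-dimensional Minkowski weights spanned by a positive weight, giving $\deg:A^d(\Sigma)\cong\mathbb R$; Poincaré duality; for $k\le d/2$ and $\ell\in\mathscr K(\Sigma)$, $\ell^{d-2k}:A^k\to A^{d-k}$ is an isomorphism and $(-1)^k\deg(\ell^{d-2k}\eta_1\eta_2)$ is positive definite on $\ker\ell^{d-2k+1}\subseteq A^k$; and stars of nonzero cones are Lefschetz. *)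

(* Defs.v *)
From HB Require Import structures.
From mathcomp Require Import all_boot all_order all_algebra.
From mathcomp Require Import generic_quotient ring_quotient finmap.
From mathcomp Require Import all_classical all_reals.
From mathcomp Require Import topology normedtype.

Set Implicit Arguments.
Unset Strict Implicit.
Unset Printing Implicit Defensive.

Import Order.TTheory GRing.Theory Num.Theory.
Import numFieldNormedType.Exports.

Local Open Scope classical_set_scope.
Local Open Scope ring_scope.
Local Open Scope quotient_scope.

Section Quotient.
Variables (R : realType) (V : vectType R) (U : {vspace V}).

(* V / U, realized on a complement of U, with projection along U. *)
Definition quotv : vectType R := subvs_of (U^C)%VS.

Definition quotpi : 'Hom(V, quotv) :=
  linfun (vsproj (U^C)%VS \o daddv_pi (U^C)%VS U).

Lemma quotpiE v : vsval (quotpi v) = daddv_pi (U^C)%VS U v.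
Proof. by rewrite lfunE /= vsprojK // memv_pi. Qed.

Lemma lker_quotpi : lker quotpi = U.
Proof.
have UC0 : (U^C :&: U = 0)%VS by rewrite capvC capv_compl.
have UCf : (U^C + U = fullv)%VS by rewrite addvC addv_complf.
have dec v : daddv_pi (U^C)%VS U v + daddv_pi U (U^C)%VS v = v.
  by apply: daddv_pi_add; rewrite ?UCf ?memvf.
apply/vspaceP => v; rewrite memv_ker; apply/eqP/idP => [|Uv].
  move=> /(congr1 vsval); rewrite quotpiE /= => pi0.
  by rewrite -(dec v) pi0 add0r memv_pi.
apply: val_inj; rewrite /= quotpiE; have := dec v.
rewrite (@daddv_pi_id _ _ U) ?capv_compl //.
by move/(canRL (addrK _)); rewrite subrr.
Qed.

Lemma limg_quotpi : limg quotpi = fullv.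
Proof.
have UC0 : (U^C :&: U = 0)%VS by rewrite capvC capv_compl.
apply/vspaceP => w; rewrite memvf; apply/memv_imgP; exists (vsval w).
  exact: memvf.
by apply: val_inj; rewrite /= quotpiE daddv_pi_id ?subvsP.
Qed.

End Quotient.

Section Lattice.
Variables (R : realType) (V : vectType R).

Definition is_lattice (L : set V) : Prop :=
  exists n (b : n.-tuple V),
    basis_of fullv b /\ L = [set v | inIntSpan b v].

Definition primitive (L : set V) (u : V) : Prop :=
  L u /\ forall u' (k : nat), L u' -> u = u' *+ k -> k = 1%N.

Definition prim (L : set V) (v : V) : V :=
  xget 0 [set u | primitive L u /\ exists k : nat, v = u *+ k].

Lemma lattice_add L u v : is_lattice L -> L u -> L v -> L (u + v).
Proof.
case=> n [b [_ ->]] [a ->] [c ->]; exists [ffun i => a i + c i].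
by rewrite -big_split; apply: eq_bigr => i _; rewrite ffunE mulrzDr.
Qed.

Lemma intspan_coord n (b : n.-tuple V) (a : 'I_n -> int) i : free b ->
  coord b i (\sum_(j < n) b`_j *~ a j) = (a i)%:~R.
Proof.
move=> fb; rewrite raddf_sum (bigD1 i) //= big1 => [|j ji].
  by rewrite addr0 raddfMz /= coord_free // eqxx.
by rewrite raddfMz /= coord_free // (negbTE ji) mul0rz.
Qed.

Lemma primP L v : is_lattice L -> L v -> v != 0 ->
  primitive L (prim L v) /\ exists k : nat, (0 < k)%N /\ v = prim L v *+ k.
Proof.
move=> lL Lv v0.
have [n [b [bb LE]]] := lL; have fb := basis_free bb.
suff [u [pu [k vk]]] : exists u, primitive L u /\ exists k : nat, v = u *+ k.
  rewrite /prim; case: xgetP => [w _ [pw [m vm]]|/(_ u) []]; last first.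
    by split=> //; exists k.
  split=> //; exists m; split=> //; case: m vm => // vm.
  by rewrite vm mulr0n eqxx in v0.
have [a va] : inIntSpan b v by move: Lv; rewrite LE.
have [i ai0] : exists i, a i != 0.
  apply/existsP; apply: contra_neqT v0 => /existsPn a0.
  rewrite va big1 // => i _.
  by have := a0 i; rewrite negbK => /eqP ->; rewrite mulr0z.
pose P (m : nat) := `[< exists u, L u /\ v = u *+ m >].
have P1 : exists m, P m.
  by exists 1%N; apply/asboolP; exists v.
have Pb m : P m -> (m <= absz (a i))%N.
  move=> /asboolP[u [Lu vu]]; have [c uc] : inIntSpan b u by move: Lu; rewrite LE.
  have : coord b i v = coord b i v by [].
  rewrite {1}va vu uc intspan_coord // raddfMn /= intspan_coord //.
  move=> /eqP; rewrite -mulr_natr pmulrn -intrM eqr_int => /eqP ac.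
  have : (m %| absz (a i))%N by rewrite ac abszM dvdn_mull.
  by move/dvdn_leq; apply; rewrite absz_gt0.
case: (ex_maxnP P1 Pb) => m /asboolP[u [Lu vu]] mmax.
exists u; split; last by exists m.
split=> // u' k Lu' uu'.
have m0 : (0 < m)%N by case: (m) vu => // vu; rewrite vu mulr0n eqxx in v0.
have k0 : (0 < k)%N.
  by case: (k) uu' => // uu'; rewrite vu uu' mulr0n mul0rn eqxx in v0.
have : (k * m <= m)%N.
  by apply: mmax; apply/asboolP; exists u'; rewrite mulrnA -uu'.
rewrite -{2}[m]mul1n leq_pmul2r // => k1.
by apply/eqP; rewrite eqn_leq k1.
Qed.

End Lattice.

Section QuotLattice.
Variables (R : realType) (V W : vectType R) (f : 'Hom(V, W)).

Lemma image_lattice (L : set V) (g : seq V) :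
  is_lattice L -> {in g, forall v, L v} ->
  limg f = fullv -> lker f = <<g>>%VS -> is_lattice (f @` L).
Proof.
case=> n [b [bb LE]] gL fs fk.
pose k := size g.
have gspan (i : 'I_k) : exists a : {ffun 'I_n -> int},
    g`_i = \sum_(j < n) b`_j *~ a j.
  by have := gL g`_i (mem_nth _ (ltn_ord i)); rewrite LE.
have [A gA] := choice gspan.
pose M : 'M[int]_(k, n) := \matrix_(i, j) A i j.
have [P Pu [Q Qu [d _ ME]]] := int_Smith_normal_form M.
set D := (\matrix_(i, j) _) in ME.
pose b' (i : 'I_n) := \sum_(j < n) b`_j *~ Q i j.
have bb' (j : 'I_n) : b`_j = \sum_(i < n) b' i *~ (invmx Q) j i.
  rewrite (eq_bigr (fun i => \sum_(l < n) b`_l *~ (invmx Q j i * Q i l))).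
    rewrite exchange_big /= (bigD1 j) //= [X in _ + X]big1 => [|l lj].
      rewrite addr0 -mulrz_sumr.
      have := congr1 (fun N : 'M[int]_n => N j j) (mulVmx Qu).
      by rewrite !mxE eqxx => ->.
    rewrite -mulrz_sumr.
    have := congr1 (fun N : 'M[int]_n => N j l) (mulVmx Qu).
    by rewrite !mxE eq_sym (negbTE lj) => ->.
  move=> i _; rewrite /b' mulrz_suml; apply: eq_bigr => l _.
  by rewrite -mulrzA mulrC.
have gE (i : 'I_k) : g`_i = \sum_(j < n) b' j *~ (P *m D) i j.
  rewrite gA (eq_bigr (fun l : 'I_n => \sum_(j < n) b`_l *~ ((P *m D) i j * Q j l))).
    rewrite exchange_big /=; apply: eq_bigr => j _.
    rewrite /b' mulrz_suml; apply: eq_bigr => l _.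
    by rewrite -mulrzA mulrC.
  move=> l _; rewrite -mulrz_sumr.
  have := congr1 (fun N : 'M[int]_(k, n) => N i l) ME.
  by rewrite [LHS]mxE [RHS]mxE => ->.
have Dg (i : 'I_k) (j : 'I_n) : i = j :> nat -> b' j *~ d`_i \in <<g>>%VS.
  move=> ij.
  have -> : b' j *~ d`_i = \sum_(l < k) g`_l *~ (invmx P) i l.
    rewrite (eq_bigr (fun l => \sum_(m < n) b' m *~ (invmx P i l * (P *m D) l m))).
      rewrite exchange_big /=.
      rewrite (eq_bigr (fun m => b' m *~ D i m)).
        rewrite (bigD1 j) //= [X in _ + X]big1 => [|m mj].
          by rewrite addr0 mxE ij eqxx mulr1n.
        rewrite mxE ij (negbTE (_ : (j : nat) != m)) ?mulr0n ?mulr0z //.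
        by apply: contraNneq mj => /val_inj ->.
      move=> m _; rewrite -mulrz_sumr.
      have := congr1 (fun N : 'M[int]_(k, n) => N i m) (mulKmx Pu D).
      by rewrite [LHS]mxE => ->.
    move=> l _; rewrite gE mulrz_suml; apply: eq_bigr => m _.
    by rewrite -mulrzA mulrC.
  by apply: memv_suml => l _; rewrite rpredMz // memv_span // mem_nth.
pose J := [pred j : 'I_n | (j < k)%N && (d`_j != 0)].
have J0 j : J j -> f (b' j) = 0.
  case/andP=> jk dj; apply/eqP; rewrite -memv_ker fk.
  have := Dg (Ordinal jk) j erefl.
  rewrite -scaler_int => /(memvZ (d`_j)%:~R^-1).
  by rewrite scalerA mulVf ?scale1r // intr_eq0.
pose c := [seq f (b' j) | j <- enum 'I_n & ~~ J j].
have span_c : <<c>>%VS = fullv.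
  apply/eqP; rewrite eqEsubv subvf /= -fs -(span_basis bb) limg_span.
  apply/span_subvP => w /mapP[v /(nthP 0)[j + <-] ->].
  rewrite size_tuple => jn; rewrite (bb' (Ordinal jn)) raddf_sum.
  apply: memv_suml => i _; rewrite raddfMz; apply: rpredMz.
  have [Ji|nJi] := boolP (J i); first by rewrite /= J0 // mem0v.
  by apply/memv_span/mapP; exists i => //; rewrite mem_filter nJi mem_enum.
have nV : n = \dim {:V} by rewrite -(size_basis bb).
have gdim : (\dim <<g>> <= #|J|)%N.
  have sub : (<<g>> <= << [seq b' j | j in J] >>)%VS.
    apply/span_subvP => v /(nthP 0)[i ik <-]; rewrite (gE (Ordinal ik)).
    apply: memv_suml => j _; rewrite mxE mulrz_sumr; apply: memv_suml => l _.
    rewrite mxE; have [lj|] := eqVneq (l : nat) j; last first.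
      by rewrite mulr0n mulr0 mulr0z mem0v.
    have [d0|d0] := eqVneq d`_l 0.
      by rewrite d0 mul0rn mulr0 mulr0z mem0v.
    apply/rpredMz/memv_span/map_f; rewrite mem_enum inE /= -lj ltn_ord.
    exact: d0.
  apply: leq_trans (dimvS sub) _; apply: leq_trans (dim_span _) _.
  by rewrite size_map -cardE.
have size_c : (size c <= \dim {:W})%N.
  have := limg_ker_dim f fullv; rewrite capfv fk fs -nV => dE.
  rewrite size_map -(leq_add2l #|J|).
  have -> : (#|J| + size [seq j <- enum 'I_n | ~~ J j] = n)%N.
    rewrite -[RHS](size_enum_ord n) -[RHS](count_predC J) size_filter.
    congr (_ + _)%N.
    by rewrite cardE -size_filter enumT /enum_mem.
  by rewrite -{1}dE leq_add2r.
exists (size c), (in_tuple c); split; first by rewrite basisEdim span_c subvv.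
apply/seteqP; split=> [w [v + <-]|w /= [a ->]].
  rewrite LE => -[a ->] /=.
  have cP j : exists a : {ffun 'I_(size c) -> int},
     f (b' j) = \sum_(i < size c) c`_i *~ a i.
    have [Jj|nJj] := boolP (J j).
      exists [ffun=> 0]; rewrite J0 // big1 // => i _.
      by rewrite ffunE mulr0z.
    have : f (b' j) \in c by apply/mapP; exists j => //; rewrite mem_filter nJj mem_enum.
    move=> /(nthP 0)[i ic <-]; exists [ffun l => (l == Ordinal ic)%:Z].
    rewrite (bigD1 (Ordinal ic)) //= ffunE eqxx big1 ?addr0 // => l li.
    by rewrite ffunE (negbTE li) mulr0z.
  have [C CE] := choice cP.
  exists [ffun i => \sum_(j < n) \sum_(l < n) C l i * ((invmx Q) j l * a j)].
  rewrite raddf_sum.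
  rewrite (eq_bigr (fun j => \sum_(l < n) \sum_(i < size c)
    c`_i *~ (C l i * ((invmx Q) j l * a j)))).
    rewrite (eq_bigr (fun j => \sum_(i < size c) \sum_(l < n)
      c`_i *~ (C l i * ((invmx Q) j l * a j)))) => [|j _]; last first.
      exact: exchange_big.
    rewrite exchange_big; apply: eq_bigr => i _ /=.
    rewrite ffunE mulrz_sumr; apply: eq_bigr => j _.
    by rewrite mulrz_sumr.
  move=> j _; rewrite raddfMz bb' raddf_sum mulrz_suml; apply: eq_bigr => l _.
  rewrite raddfMz /= CE 2!mulrz_suml; apply: eq_bigr => i _.
  by rewrite -!mulrzA.
have Lb' j : L (b' j) by rewrite LE; exists [ffun l => Q j l]; apply: eq_bigr => l _; rewrite ffunE.
have Lz v (z : int) : L v -> L (v *~ z).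
  rewrite LE => -[e ->]; exists [ffun i => e i * z].
  by rewrite mulrz_suml; apply: eq_bigr => i _; rewrite ffunE mulrzA.
have L0 : L 0.
  by rewrite LE; exists [ffun=> 0]; rewrite big1 // => i _; rewrite ffunE mulr0z.
have Ladd u v : L u -> L v -> L (u + v).
  by apply: lattice_add; exists n, b.
apply: (big_ind (fun w => (f @` L) w)).
- by exists 0 => //; rewrite raddf0.
- by move=> _ _ [u Lu <-] [v Lv <-]; exists (u + v); rewrite ?raddfD //; exact: Ladd.
- move=> i _; have /mapP[j _ cj] : c`_i \in c by exact: mem_nth.
  by exists (b' j *~ a i); [exact/Lz/Lb'|rewrite raddfMz /= cj].
Qed.

End QuotLattice.

Section PosHull.
Variables (R : realType) (V : vectType R) (I : finType) (e : I -> V).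

Definition poshull (S : {set I}) : set V :=
  [set v | exists2 a : I -> R,
     forall i, 0 <= a i & v = \sum_(i in S) a i *: e i].

Lemma free_imageP (S : {set I}) :
  reflect (forall a : I -> R,
             \sum_(i in S) a i *: e i = 0 -> forall i, i \in S -> a i = 0)
          (free [seq e i | i in S]).
Proof.
have sumE (a : I -> R) : \sum_(i in S) a i *: e i =
    \sum_(j < size [seq e i | i in S]) a (tnth (in_tuple (enum S))
      (cast_ord (size_map _ _) j)) *: [seq e i | i in S]`_j.
  rewrite -big_enum (big_tnth _ _ (enum S)) /=.
  rewrite (reindex (cast_ord (size_map e (enum S)))) /=; last first.
    by exists (cast_ord (esym (size_map e (enum S)))) => j _;
      rewrite ?cast_ordK ?cast_ordKV.
  apply: eq_bigr => j _; congr (_ *: _).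
  have jS : (j < size (enum S))%N by have := ltn_ord j; rewrite {2}size_map.
  pose x0 := tnth (in_tuple (enum S)) (Ordinal jS).
  by rewrite (tnth_nth x0) /= (nth_map x0).
apply: (iffP (@freeP _ _ _ (in_tuple [seq e i | i in S]))) => [fS a a0 i iS|fS k k0 j].
  rewrite sumE in a0; have := fS _ a0.
  have ilt : (index i (enum S) < size [seq e i | i in S])%N.
    by rewrite size_map index_mem mem_enum.
  move=> /(_ (Ordinal ilt)).
  by rewrite (tnth_nth i) /= nth_index // mem_enum.
pose h i := odflt 0 (omap k (insub (index i (enum S)))).
have hE (l : 'I_(size [seq e i | i in S])) :
    h (tnth (in_tuple (enum S)) (cast_ord (size_map _ _) l)) = k l.
  have lS : (l < size (enum S))%N by have := ltn_ord l; rewrite {2}size_map.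
  pose x0 := tnth (in_tuple (enum S)) (Ordinal lS).
  by rewrite /h (tnth_nth x0) /= index_uniq ?enum_uniq // valK.
rewrite -hE; apply: fS; last by rewrite -mem_enum mem_tnth.
by rewrite sumE; under eq_bigr do rewrite hE.
Qed.

End PosHull.

(* A rational simplicial fan in V = R (x) lat; a cone is recorded as the set of
   its rays, and a ray by its primitive generator. *)
Record fan (R : realType) (V : vectType R) := Fan {
  lat : set V;
  ray : finType;
  gen : ray -> V;
  cones : {set {set ray}};
  lat_lattice : is_lattice lat;
  gen_primitive : forall i, primitive lat (gen i);
  cones0 : finset.set0 \in cones;
  cones1 : forall i, [set i]%SET \in cones;
  cones_face : forall S T : {set ray},
    (S \subset T)%B -> T \in cones -> S \in cones;
  cones_free : forall S : {set ray}, S \in cones -> free [seq gen i | i in S];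
  cones_meet : forall S T : {set ray}, S \in cones -> T \in cones ->
    poshull gen S `&` poshull gen T `<=` poshull gen (S :&: T)%SET
}.

Section Fan.
Variables (R : realType) (V : vectType R) (F : fan V).
Implicit Types (S T : {set ray F}).

Definition cone_type := {S : {set ray F} | S \in cones F}.

Definition cone_span S : {vspace V} := <<[seq gen i | i in S]>>%VS.

Definition fan_dim : nat := \max_(S in cones F) #|S|.

Definition support : set V :=
  [set v | exists2 S, S \in cones F & poshull (@gen _ _ F) S v].

Lemma cone_freeP S : S \in cones F -> forall a : ray F -> R,
  \sum_(i in S) a i *: gen i = 0 -> forall i, i \in S -> a i = 0.
Proof. by move/cones_free/free_imageP. Qed.

Lemma gen_neq0 (i : ray F) : gen i != 0.
Proof.
apply/eqP => i0; have [L0 /(_ _ 2%N L0)] := gen_primitive i.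
by rewrite i0 mul0rn => /(_ erefl).
Qed.

Lemma cone_coord S T (a b : ray F -> R) : S \in cones F -> T \in cones F ->
  (forall i, 0 <= a i) -> (forall i, 0 <= b i) ->
  \sum_(i in S) a i *: gen i = \sum_(i in T) b i *: gen i ->
  forall i, (if i \in S then a i else 0) = (if i \in T then b i else 0).
Proof.
move=> Sc Tc a0 b0 ab.
have [] := @cones_meet _ _ F S T Sc Tc (\sum_(i in S) a i *: gen i).
  by split; [exists a|exists b].
move=> c c0 acE.
have key (P : {set ray F}) (q : ray F -> R) : P \in cones F ->
    (S :&: T \subset P)%SET%B ->
    \sum_(i in P) q i *: gen i = \sum_(i in (S :&: T)%SET) c i *: gen i ->
    forall i, (if i \in P then q i else 0) = (if i \in (S :&: T)%SET then c i else 0).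
  move=> Pc sub qE i; have [iP|iP] := boolP (i \in P); last first.
    by rewrite (contraNF (fintype.subsetP sub i) iP).
  apply/eqP; rewrite -subr_eq0; apply/eqP.
  apply: (cone_freeP Pc (a := fun i => q i - (if i \in (S :&: T)%SET then c i else 0))) => //.
  under eq_bigr do rewrite scalerBl.
  rewrite sumrB qE [in X in _ - X](bigID (fun i => i \in (S :&: T)%SET)) /=.
  rewrite [X in _ - (_ + X)]big1 => [|j /andP[_ /negbTE ->]]; last by rewrite scale0r.
  rewrite addr0; apply/eqP; rewrite subr_eq0; apply/eqP.
  apply: eq_big => [j|j jST]; last by rewrite jST.
  by rewrite andb_idl // => /(fintype.subsetP sub).
move=> i; rewrite (key S a) ?subsetIl // (key T b) ?subsetIr //.
by rewrite -ab.
Qed.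

End Fan.

Section Star.
Variables (R : realType) (V : vectType R) (F : fan V) (s : cone_type F).

Definition starV : vectType R := quotv (cone_span (val s)).

Definition starpi : 'Hom(V, starV) := quotpi (cone_span (val s)).

(* A ray of the star is the image of a ray i outside s such that s and i span a
   cone; a cone of the star is recorded by the rays outside s of the cone of F
   it is the image of. *)
Definition star_ray : finType :=
  {i : ray F | (i \notin val s) && ((i |: val s)%SET \in cones F)}.

Definition star_lat : set starV := starpi @` (@lat _ _ F).

Definition star_gen (i : star_ray) : starV := prim star_lat (starpi (gen (val i))).

Definition star_join (S : {set star_ray}) : {set ray F} :=
  ([set val i | i in S] :|: val s)%SET.

Definition star_cones : {set {set star_ray}} :=
  [set S : {set star_ray} | star_join S \in cones F]%SET.

Lemma star_lattice : is_lattice star_lat.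
Proof.
apply: (@image_lattice _ _ _ starpi _ [seq gen i | i in val s]).
- exact: lat_lattice.
- by move=> _ /mapP[i _ ->]; case: (gen_primitive i).
- exact: limg_quotpi.
- exact: lker_quotpi.
Qed.

Lemma star_notin (i : star_ray) : val i \notin val s.
Proof. by case/andP: (valP i). Qed.

Lemma sum_join (S : {set star_ray}) (a : ray F -> V) :
  \sum_(i in star_join S) a i =
  \sum_(i in S) a (val i) + \sum_(i in val s) a i.
Proof.
have dis : [disjoint [set val i | i in S]%SET & val s]%B.
  rewrite disjoint_subset; apply/fintype.subsetP => _ /imsetP[i _ ->].
  exact: star_notin.
rewrite (eq_bigl _ _ (fun i => finset.in_setU i _ _)) bigU //=; congr (_ + _).
by rewrite big_imset //= => i j _ _ /val_inj.
Qed.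

Lemma mem_star_join (S : {set star_ray}) (i : star_ray) :
  (val i \in star_join S) = (i \in S).
Proof.
rewrite finset.in_setU (negbTE (star_notin i)) orbF; apply/imsetP/idP => [[j jS]|iS].
  by move/val_inj ->.
by exists i.
Qed.

Lemma starpi_eq0 v : starpi v = 0 ->
  exists c : ray F -> R, v = \sum_(i in val s) c i *: gen i.
Proof.
move=> /eqP; rewrite -memv_ker lker_quotpi /cone_span span_def big_map big_enum.
move=> /memv_sumP[u us ->].
have ex i : exists c : R, i \in val s -> u i = c *: gen i.
  have [si|si] := boolP (i \in val s); last by exists 0.
  by have /vlineP[c ->] := us i si; exists c.
have [c cE] := choice ex.
by exists c; apply: eq_bigr => i /cE.
Qed.

Let glue (a : star_ray -> R) (c : ray F -> R) (j : ray F) : R :=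
  if insub j is Some i then a i else c j.

Let glue_val a c (i : star_ray) : glue a c (val i) = a i.
Proof. by rewrite /glue valK. Qed.

Let glue_s a c i : i \in val s -> glue a c i = c i.
Proof. by move=> si; rewrite /glue insubN // si. Qed.

Let sum_glue S a c : \sum_(i in star_join S) glue a c i *: gen i =
  \sum_(i in S) a i *: gen (val i) + \sum_(i in val s) c i *: gen i.
Proof.
rewrite sum_join; congr (_ + _).
  by apply: eq_bigr => i _; rewrite glue_val.
by apply: eq_bigr => i si; rewrite glue_s.
Qed.

Lemma starpi_gen_neq0 (i : star_ray) : starpi (gen (val i)) != 0.
Proof.
apply/eqP => /starpi_eq0[c cE].
have ic : star_join [set i]%SET \in cones F.
  by rewrite /star_join imset_set1; case/andP: (valP i).
have := cone_freeP ic (a := glue (fun=> 1) (fun j => - c j)).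
move=> /(_ _ (val i)); rewrite mem_star_join inE eqxx glue_val.
have -> : \sum_(j in star_join [set i]%SET)
    glue (fun=> 1) (fun j => - c j) j *: gen j = 0.
  rewrite sum_glue big_set1 scale1r cE -big_split big1 //= => j _.
  by rewrite scaleNr subrr.
by move=> /(_ erefl isT)/eqP; rewrite oner_eq0.
Qed.

Lemma star_genP (i : star_ray) : primitive star_lat (star_gen i) /\
  exists k : nat, (0 < k)%N /\ starpi (gen (val i)) = star_gen i *+ k.
Proof.
apply: primP; [exact: star_lattice| |exact: starpi_gen_neq0].
by exists (gen (val i)) => //; case: (gen_primitive (val i)).
Qed.

Lemma star_genE : exists k : star_ray -> R,
  forall i, 0 < k i /\ star_gen i = k i *: starpi (gen (val i)).
Proof.
suff /choice[k kP] : forall i, exists x : R,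
    0 < x /\ star_gen i = x *: starpi (gen (val i)) by exists k.
move=> i.
have [_ [k [k0 ->]]] := star_genP i; exists (k%:R^-1); rewrite invr_gt0 ltr0n.
by split=> //; rewrite -[star_gen i *+ k]scaler_nat scalerA mulVf ?scale1r // pnatr_eq0 -lt0n.
Qed.

Lemma star_cones0 : finset.set0 \in star_cones.
Proof. by rewrite inE /star_join imset0 finset.set0U; exact: valP. Qed.

Lemma star_cones1 i : [set i]%SET \in star_cones.
Proof. by rewrite inE /star_join imset_set1; case/andP: (valP i). Qed.

Lemma star_face (S T : {set star_ray}) :
  (S \subset T)%B -> T \in star_cones -> S \in star_cones.
Proof.
by move=> ST; rewrite !inE; apply: cones_face; rewrite finset.setSU // imsetS.
Qed.

Lemma star_free (S : {set star_ray}) : S \in star_cones ->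
  free [seq star_gen i | i in S].
Proof.
rewrite inE => Sc; apply/free_imageP => a a0 i iS.
have [k kP] := star_genE.
have : starpi (\sum_(i in S) (a i * k i) *: gen (val i)) = 0.
  rewrite -a0 linear_sum; apply: eq_bigr => j _.
  by rewrite linearZ /= (kP j).2 scalerA.
move=> /starpi_eq0[c cE].
have := cone_freeP Sc (a := glue (fun i => a i * k i) (fun j => - c j)).
move=> /(_ _ (val i)); rewrite mem_star_join iS glue_val sum_glue cE -big_split.
rewrite big1 /= => [/(_ erefl isT)/eqP|j _]; last by rewrite scaleNr subrr.
by rewrite mulf_eq0 (gt_eqF (kP i).1) orbF => /eqP.
Qed.

Lemma star_meet (S T : {set star_ray}) : S \in star_cones -> T \in star_cones ->
  poshull star_gen S `&` poshull star_gen T `<=` poshull star_gen (S :&: T)%SET.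
Proof.
rewrite !inE => Sc Tc v [[a a0 va] [b b0 vb]].
have [k kP] := star_genE.
have : starpi (\sum_(i in S) (a i * k i) *: gen (val i)
             - \sum_(i in T) (b i * k i) *: gen (val i)) = 0.
  apply/eqP; rewrite linearB subr_eq0; apply/eqP.
  transitivity v; [rewrite va|rewrite vb]; rewrite linear_sum;
    apply: eq_bigr => j _;
    by rewrite linearZ /= (kP j).2 scalerA.
move=> /starpi_eq0[c cE].
pose cp j := Num.max 0 (c j); pose cm j := Num.max 0 (- c j).
have cpm j : c j = cp j - cm j.
  rewrite /cp /cm; have [c0|c0] := leP 0 (c j).
    by rewrite max_l ?oppr_le0 // subr0.
  by rewrite max_r ?oppr_ge0 ?(ltW c0) // sub0r opprK.
have glue0 (q : star_ray -> R) (r : ray F -> R) : (forall i, 0 <= q i) ->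
    (forall j, 0 <= r j) -> forall j, 0 <= glue q r j.
  by move=> q0 r0 j; rewrite /glue; case: insubP.
have a'0 i : 0 <= a i * k i by rewrite mulr_ge0 // ltW // (kP i).1.
have b'0 i : 0 <= b i * k i by rewrite mulr_ge0 // ltW // (kP i).1.
have cp0 j : 0 <= cp j by rewrite le_max lexx.
have cm0 j : 0 <= cm j by rewrite le_max lexx.
have sumE : \sum_(i in star_join S) glue (fun i => a i * k i) cm i *: gen i =
    \sum_(i in star_join T) glue (fun i => b i * k i) cp i *: gen i.
  rewrite !sum_glue; have cE' : \sum_(i in val s) c i *: gen i =
      \sum_(i in val s) cp i *: gen i - \sum_(i in val s) cm i *: gen i.
    by rewrite -sumrB; apply: eq_bigr => j _; rewrite -scalerBl -cpm.
  move: cE; rewrite cE' => /(canRL (subrK _)) ->.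
  by rewrite addrAC subrK addrC.
have iE := cone_coord Sc Tc (glue0 _ _ a'0 cm0) (glue0 _ _ b'0 cp0) sumE.
exists a => //; rewrite va (bigID (fun i => i \in T)) /= [X in _ + X]big1.
  by rewrite addr0; apply: eq_bigl => i; rewrite finset.in_setI.
move=> i /andP[iS iT]; have := iE (val i).
rewrite !mem_star_join iS (negbTE iT) glue_val => /eqP.
by rewrite mulf_eq0 (gt_eqF (kP i).1) orbF => /eqP ->; rewrite scale0r.
Qed.

Definition star : fan starV :=
  @Fan R starV star_lat star_ray star_gen star_cones star_lattice
    (fun i => (star_genP i).1) star_cones0 star_cones1 star_face star_free
    star_meet.

End Star.

Section Polynomial.
Variables (R : realType) (V : vectType R).

(* A polynomial function on V, written as a linear combination of products of
   linear functionals *)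
Definition peval (p : seq (R * seq 'Hom(V, R^o))) (v : V) : R :=
  \sum_(t <- p) t.1 * \prod_(l <- t.2) (l v : R).

Definition polynomial (f : V -> R) : Prop := exists p, f =1 peval p.

Definition homogeneous (k : nat) (f : V -> R) : Prop :=
  exists2 p, all (fun t => size t.2 == k) p & f =1 peval p.

Lemma polynomial_cst (c : R) : polynomial (fun=> c).
Proof.
by exists [:: (c, [::])] => v; rewrite /peval big_seq1 big_nil mulr1.
Qed.

Lemma homogeneous_polynomial k f : homogeneous k f -> polynomial f.
Proof. by case=> p _ fp; exists p. Qed.

Lemma homogeneous_lin (l : 'Hom(V, R^o)) : homogeneous 1 l.
Proof. by exists [:: (1, [:: l])] => // v; rewrite /peval !big_seq1 mul1r. Qed.

Lemma polynomialB f g :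
  polynomial f -> polynomial g -> polynomial (fun v => f v - g v).
Proof.
move=> [p fp] [q gq]; exists (p ++ [seq (- t.1, t.2) | t <- q]) => v.
rewrite /peval big_cat big_map /= fp gq -sumrN; congr (_ + _).
by apply: eq_bigr => t _; rewrite mulNr.
Qed.

Lemma polynomialM f g :
  polynomial f -> polynomial g -> polynomial (fun v => f v * g v).
Proof.
move=> [p fp] [q gq].
exists [seq (t.1 * u.1, t.2 ++ u.2) | t <- p, u <- q] => v.
rewrite /peval big_allpairs_dep /= fp gq mulr_suml; apply: eq_bigr => t _.
rewrite mulr_sumr; apply: eq_bigr => u _.
by rewrite big_cat /= mulrACA.
Qed.

End Polynomial.

Section PiecewisePolynomial.
Variables (R : realType) (V : vectType R) (F : fan V).

Definition supportT : Type := set_type (support F).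
HB.instance Definition _ := Choice.on supportT.

Lemma support0 : 0 \in support F.
Proof.
apply/mem_set; exists finset.set0; first exact: cones0.
by exists (fun=> 0) => //; rewrite big1 // => i; rewrite finset.in_set0.
Qed.

HB.instance Definition _ := isPointed.Build supportT (SigSub support0).

Definition piecewise (P : (V -> R) -> Prop) (f : supportT -> R) : Prop :=
  forall S, S \in cones F -> exists2 p : V -> R, P p &
    forall x : supportT, poshull (@gen _ _ F) S (val x) -> f x = p (val x).

Definition pp_pred : {pred (supportT -> R)} :=
  fun f => `[< piecewise (@polynomial R V) f >].

Lemma pp_subring : subring_closed pp_pred.
Proof.
split.
- by apply/asboolP => S _; exists (fun=> 1); [exact: polynomial_cst|].
- move=> f g /asboolP fP /asboolP gP; apply/asboolP => S Sc.
  have [p pP fp] := fP S Sc; have [q qP gq] := gP S Sc.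
  exists (fun v => p v - q v); first exact: polynomialB.
  by move=> x xS; rewrite -fp // -gq.
- move=> f g /asboolP fP /asboolP gP; apply/asboolP => S Sc.
  have [p pP fp] := fP S Sc; have [q qP gq] := gP S Sc.
  exists (fun v => p v * q v); first exact: polynomialM.
  by move=> x xS; rewrite -fp // -gq.
Qed.

HB.instance Definition _ :=
  GRing.isSubringClosed.Build (supportT -> R) pp_pred pp_subring.

Record ppoly : Type := PPoly {
  ppfun :> supportT -> R;
  ppfunP : ppfun \in pp_pred }.

HB.instance Definition _ := [isSub for ppfun].
HB.instance Definition _ := [Choice of ppoly by <:].
HB.instance Definition _ := [SubChoice_isSubComNzRing of ppoly by <:].

Lemma pp_cst_subproof (c : R) : (fun=> c) \in pp_pred.
Proof.
by apply/asboolP => S _; exists (fun=> c); [exact: polynomial_cst|].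
Qed.
Definition pp_cst (c : R) : ppoly := PPoly (pp_cst_subproof c).

Lemma pp_lin_subproof (l : 'Hom(V, R^o)) : (fun x => l (val x) : R) \in pp_pred.
Proof.
apply/asboolP => S _; exists (fun v => l v : R) => //.
exact: (homogeneous_polynomial (homogeneous_lin l)).
Qed.
Definition pp_lin (l : 'Hom(V, R^o)) : ppoly := PPoly (pp_lin_subproof l).

Definition pp_lin_ideal (f : ppoly) : bool :=
  `[< exists s : seq ('Hom(V, R^o) * ppoly),
        f = \sum_(t <- s) pp_lin t.1 * t.2 >].

Lemma pp_lin_ideal_closed : idealr_closed pp_lin_ideal.
Proof.
split.
- by apply/asboolP; exists [::]; rewrite big_nil.
- apply/asboolP => -[s /(congr1 (fun f : ppoly => ppfun f point))] /eqP.
  suff -> : ppfun (\sum_(t <- s) pp_lin t.1 * t.2) point = 0 by rewrite oner_eq0.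
  elim: s => [|t s IHs]; first by rewrite big_nil.
  rewrite big_cons -[LHS]/(t.1 0 * ppfun t.2 point + ppfun (\sum_(j <- s) _) point).
  by rewrite IHs linear0 mul0r addr0.
- move=> a f g /asboolP[s ->] /asboolP[t ->]; apply/asboolP.
  exists ([seq (u.1, a * u.2) | u <- s] ++ t); rewrite big_cat big_map /=.
  by rewrite mulr_sumr; congr (_ + _); apply: eq_bigr => u _; rewrite mulrCA.
Qed.

HB.instance Definition _ := isIdealr.Build ppoly pp_lin_ideal pp_lin_ideal_closed.

Definition pp_ideal : idealr ppoly := pp_lin_ideal.

Definition chow : Type := {ideal_quot pp_ideal}.
HB.instance Definition _ := GRing.ComNzRing.on chow.
HB.instance Definition _ := Choice.on chow.

Definition cls (f : ppoly) : chow := \pi_({ideal_quot pp_ideal}) f.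


Lemma clsD f g : cls (f + g) = cls f + cls g.
Proof. exact: raddfD. Qed.
Lemma clsM f g : cls (f * g) = cls f * cls g.
Proof. exact: rmorphM. Qed.
Lemma cls1 : cls 1 = 1.
Proof. exact: rmorph1. Qed.

Lemma cls_eq f g : cls f = cls g <-> pp_lin_ideal (f - g).
Proof.
have := Quotient.idealrBE pp_ideal f g.
rewrite -[in X in X = _]topredE /= => ->; split => [/eqP|/eqP] //.
Qed.

Definition chow_scale (c : R) (x : chow) : chow := cls (pp_cst c) * x.

Lemma pp_cstM a b : pp_cst (a * b) = pp_cst a * pp_cst b.
Proof. exact: val_inj. Qed.
Lemma pp_cstD a b : pp_cst (a + b) = pp_cst a + pp_cst b.
Proof. exact: val_inj. Qed.
Lemma pp_cst1 : pp_cst 1 = 1.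
Proof. exact: val_inj. Qed.

Lemma chow_scaleA a b x : chow_scale a (chow_scale b x) = chow_scale (a * b) x.
Proof. by rewrite /chow_scale pp_cstM clsM mulrA. Qed.
Lemma chow_scale1 : left_id 1 chow_scale.
Proof. by move=> x; rewrite /chow_scale pp_cst1 cls1 mul1r. Qed.
Lemma chow_scaleDr : right_distributive chow_scale +%R.
Proof. by move=> a x y; rewrite /chow_scale mulrDr. Qed.
Lemma chow_scaleDl x : {morph chow_scale^~ x : a b / a + b}.
Proof. by move=> a b; rewrite /chow_scale pp_cstD clsD mulrDl. Qed.

HB.instance Definition _ := GRing.Zmodule_isLmodule.Build R chow
  chow_scaleA chow_scale1 chow_scaleDr chow_scaleDl.

Lemma chow_scaleAl (a : R) (x y : chow) : a *: (x * y) = (a *: x) * y.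
Proof. exact: mulrA. Qed.
HB.instance Definition _ := GRing.Lmodule_isLalgebra.Build R chow chow_scaleAl.

End PiecewisePolynomial.

Section PiecewiseLinear.
Variables (R : realType) (V : vectType R) (F : fan V).

(* The piecewise linear function on F taking the value c i at gen i *)
Definition pl_fun (c : ray F -> R) (x : supportT F) : R :=
  xget 0 [set r | exists S (a : ray F -> R),
    [/\ S \in cones F, forall i, 0 <= a i,
        val x = \sum_(i in S) a i *: gen i & r = \sum_(i in S) a i * c i]].

Lemma pl_funE c S (a : ray F -> R) (x : supportT F) :
  S \in cones F -> (forall i, 0 <= a i) ->
  val x = \sum_(i in S) a i *: gen i -> pl_fun c x = \sum_(i in S) a i * c i.
Proof.
move=> Sc a0 xa; rewrite /pl_fun; case: xgetP => [r _|]; last first.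
  by move=> /(_ (\sum_(i in S) a i * c i)) []; exists S, a.
move=> [T [b [Tc b0 xb ->]]].
have ba := cone_coord Tc Sc b0 a0 (etrans (esym xb) xa).
rewrite big_mkcond [RHS]big_mkcond; apply: eq_bigr => i _.
have := ba i; do 2 case: ifP => //= _; first by move=> ->.
- by move=> ->; rewrite mul0r.
- by move=> <-; rewrite mul0r.
Qed.

Lemma pl_fun_piecewise c : piecewise (homogeneous 1) (pl_fun c).
Proof.
move=> S Sc.
have [f fE] := linear_of_free [seq gen i | i in S] [seq (c i : R^o) | i in S].
have {}fE i : i \in S -> f (gen i) = c i.
  move=> iS; have := fE (cones_free Sc); rewrite !size_map => /(_ erefl).
  by rewrite -map_comp => /eq_in_map; apply; rewrite mem_enum.
exists (linfun f); first exact: homogeneous_lin.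
move=> x [a a0 xa]; rewrite (pl_funE c Sc a0 xa) xa lfunE /= linear_sum.
by apply: eq_bigr => i iS; rewrite linearZ /= fE.
Qed.

Lemma pl_subproof c : pl_fun c \in @pp_pred R V F.
Proof.
apply/asboolP => S Sc; have [p pP pE] := pl_fun_piecewise c Sc.
by exists p => //; exact: homogeneous_polynomial pP.
Qed.

Definition pl (c : ray F -> R) : ppoly F := PPoly (pl_subproof c).

Definition courant (i : ray F) : ppoly F := pl (fun j => (i == j)%:R).

Definition pp_hom (k : nat) (f : ppoly F) : Prop := piecewise (homogeneous k) f.

Definition positive (f : ppoly F) : Prop :=
  forall x : supportT F, val x != 0 -> 0 < f x.

End PiecewiseLinear.

Section Chow.
Variables (R : realType) (V : vectType R) (F : fan V).

Definition chow_deg (k : nat) : set (chow F) :=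
  [set x | exists2 f, pp_hom k f & x = cls f].

(* The vector e_{S/t} of the balancing condition, for S = i |: t, is the primitive
   generator of the ray i of the star of t. *)
Definition minkowski_weight (k : nat) (w : {set ray F} -> R) : Prop :=
  forall t : cone_type F, #|val t|.+1 = k ->
    \sum_(i : ray (star t)) w (val i |: val t)%SET *: gen i = 0.

Definition fundamental_weight (d : nat) (w : {set ray F} -> R) : Prop :=
  [/\ minkowski_weight d w,
      forall S, S \in cones F -> #|S| = d -> 0 < w S &
      forall w', minkowski_weight d w' -> exists c : R,
        forall S, S \in cones F -> #|S| = d -> w' S = c * w S].

(* The cosets, in the lattice of integral points of the span of S, of the
   sublattice generated by the rays of S; mult S is the index. *)
Definition lat_cosets (S : {set ray F}) : set (set V) :=
  [set C | exists v, [/\ lat F v, v \in cone_span S &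
     C = [set u | exists a : ray F -> int,
                    u = v + \sum_(i in S) gen i *~ a i]]].

Definition mult (S : {set ray F}) : nat := #|` fset_set (lat_cosets S)|.

(* deg is the functional on A^d(F) given by a d-dimensional weight w; its values
   on the other graded pieces are left free. *)
Definition degree_map (d : nat) (w : {set ray F} -> R) (deg : {scalar chow F}) :
    Prop :=
  forall S, S \in cones F -> #|S| = d ->
    deg (\prod_(i in S) cls (courant i)) *+ mult S = w S.

(* The graph of the restriction homomorphism to the star: the piecewise
   polynomial g on the star, pulled back to the union of the cones containing s,
   agrees with f modulo the ideal generated by global linear functions. *)
Definition star_restriction (s : cone_type F) (x : chow F) (y : chow (star s)) :
    Prop :=
  exists (f : ppoly F) (g : ppoly (star s)) (r : seq ('Hom(V, R^o) * ppoly F)),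
    [/\ x = cls f, y = cls g &
      forall (S : {set ray F}) (v : supportT F) (u : supportT (star s)),
        S \in cones F -> (val s \subset S)%B -> poshull (@gen _ _ F) S (val v) ->
        val u = starpi s (val v) ->
        f v = g u + \sum_(t <- r) t.1 (val v) * t.2 v].

Definition ample_cone : set (chow F) :=
  [set l | chow_deg 1 l /\
    forall s : cone_type F, exists g : ppoly (star s),
      [/\ pp_hom 1 g, positive g & star_restriction l (cls g)]].

(* Closure for the Euclidean topology of the finite-dimensional space A^1(F), as
   a quotient of the space R^rays of piecewise linear functions *)
Definition chow1_vec (c : 'rV[R]_#|ray F|) : chow F :=
  cls (pl (fun i => c 0 (enum_rank i))).

Definition chow1_closure (K : set (chow F)) : set (chow F) :=
  chow1_vec @` closure (chow1_vec @^-1` K).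

Definition poincare_duality (d : nat) (deg : {scalar chow F}) : Prop :=
  forall k, (k <= d)%N ->
    (forall x, chow_deg k x ->
       (forall y, chow_deg (d - k) y -> deg (x * y) = 0) -> x = 0) /\
    (forall y, chow_deg (d - k) y ->
       (forall x, chow_deg k x -> deg (x * y) = 0) -> y = 0).

Definition hard_lefschetz (d : nat) : Prop :=
  forall k (l : chow F), (2 * k <= d)%N -> ample_cone l ->
    set_bij (chow_deg k) (chow_deg (d - k)) (fun x => l ^+ (d - 2 * k) * x).

Definition hodge_riemann (d : nat) (deg : {scalar chow F}) : Prop :=
  forall k (l x : chow F), (2 * k <= d)%N -> ample_cone l -> chow_deg k x ->
    l ^+ (d - 2 * k).+1 * x = 0 -> x != 0 ->
    0 < (-1) ^+ k * deg (l ^+ (d - 2 * k) * x * x).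

End Chow.

Inductive lefschetz (R : realType) (V : vectType R) (F : fan V) (d : nat) : Prop :=
  Lefschetz (w : {set ray F} -> R) (deg : {scalar chow F}) of
    fan_dim F = d &
    fundamental_weight d w &
    degree_map d w deg &
    poincare_duality d deg &
    hard_lefschetz F d &
    hodge_riemann d deg &
    forall t : cone_type F, (0 < #|val t|)%N -> lefschetz (star t) (d - #|val t|).

(* Main.v *)
(* The Hodge index inequality is proved for ample classes by induction on the
   dimension d, and then passes to the closure by continuity in each class.

   Write X_i for the class of the ray i, let m, l_4, ..., l_d be ample, and write
   m = sum_i c_i X_i with c_i > 0.  Put Q(x, y) = deg(x y m l_4 ... l_d),
   M_ij = Q(X_i, X_j) and p_i = Q(X_i, m) > 0.  Ample classes restrict to ample
   classes on the star of a ray i, and deg(X_i z) is a positive multiple of the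
   degree of the restriction of z.  So the inequality on the star of i gives
   deg(X_i x x l_4 ... l_d) <= Q(X_i, x)^2 / p_i, and summing with weights c_i
   yields the Bochner inequality Q(x, x) <= sum_i (c_i / p_i) Q(X_i, x)^2.  On
   R^rays with the weights p_i / c_i, the self-adjoint operator A attached to Q
   thus satisfies A <= A^2.  Moreover M_ij >= 0 for i <> j and A c = c, so A <= 1,
   and the 1-eigenspace is the line of c once the graph of pairs with M_ij > 0 is
   connected; the latter follows from the Hodge-Riemann relation in degree one
   for the powers of m.  Hence A <= 0 on the orthogonal complement of c, that is,
   Q is negative semidefinite on the orthogonal of m. *)
Require Import Defs.
From mathcomp Require Import all_boot all_order all_algebra.
From mathcomp Require Import all_classical all_reals.
From mathcomp Require Import topology normedtype.
From mathcomp Require Import ring lra zify.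
Set Implicit Arguments.
Unset Strict Implicit.
Unset Printing Implicit Defensive.
Import Order.TTheory GRing.Theory Num.Theory.
Import numFieldNormedType.Exports.
Local Open Scope classical_set_scope.
Local Open Scope ring_scope.

(** * Hyperbolic matrices *)

(** The image of a symmetric matrix is the orthogonal of its kernel: the columns of [cokermx N],
    transposed, lie in the kernel of [N], so [u] is orthogonal to each of them. *)
Lemma symmetric_image (R : fieldType) n (N : 'M[R]_n) (u : 'rV[R]_n) :
  N^T = N -> (forall v : 'rV[R]_n, v *m N = 0 -> u *m v^T = 0) ->
  exists y, u = y *m N.
Proof.
move=> Ns uN; apply/submxP; rewrite submxE; apply/eqP/trmx_inj/row_matrixP => j.
rewrite trmx0 row0 trmx_mul row_mul -[LHS]trmxK trmx_mul trmxK uN ?trmx0 //.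
by rewrite -row_mul -{2}Ns -trmx_mul mulmx_coker trmx0 row0.
Qed.

Section Bochner.
Variables (R : realFieldType) (n : nat) (M : 'I_n -> 'I_n -> R) (c p : 'I_n -> R).
Hypothesis M_sym : forall i j, M i j = M j i.
Hypothesis M_ge0 : forall i j, i != j -> 0 <= M i j.
Hypothesis c_gt0 : forall i, 0 < c i.
Hypothesis p_gt0 : forall i, 0 < p i.
Hypothesis pE : forall i, \sum_j M i j * c j = p i.
Hypothesis M_connected : forall A : {set 'I_n}, A != finset.set0 ->
  (forall i j, i \in A -> j \notin A -> M i j = 0) -> A = finset.setT.
Hypothesis M_bochner : forall z : 'I_n -> R,
  \sum_i \sum_j M i j * (z i * z j) <=
  \sum_i c i / p i * (\sum_j M i j * z j) ^+ 2.

Let D i := p i / c i.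
(** For the scalar product with weights [D], this is the form of [1 - A], where [A] sends [x] to
    [D^-1 M x]. *)
Let N (x y : 'I_n -> R) := \sum_i D i * (x i * y i) - \sum_i \sum_j M i j * (x i * y j).

(** By [pE] the weighted norm is the sum of the terms [M i j * c j * (x i ^+ 2 / c i)], so [N] is a
    Dirichlet form in the ratios [x i / c i]. The diagonal entries of [M], whose sign is unknown,
    drop out. *)
Let NE x : N x x = 2^-1 * \sum_i \sum_j M i j * (c i * c j * (x i / c i - x j / c j) ^+ 2).
Proof.
have -> : \sum_i \sum_j M i j * (c i * c j * (x i / c i - x j / c j) ^+ 2) =
   \sum_i \sum_j (M i j * c j * (x i ^+ 2 / c i)) - 2 * (\sum_i \sum_j M i j * (x i * x j))
   + \sum_i \sum_j (M i j * c i * (x j ^+ 2 / c j)).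
  rewrite mulr_sumr -sumrB -big_split; apply: eq_bigr => i _ /=.
  rewrite mulr_sumr -sumrB -big_split; apply: eq_bigr => j _ /=.
  by field; rewrite !gt_eqF.
rewrite [X in _ + X]exchange_big /=.
have -> : \sum_j \sum_i M i j * c i * (x j ^+ 2 / c j) = \sum_i D i * (x i * x i).
  apply: eq_bigr => j _; rewrite -mulr_suml (eq_bigr (fun i => M j i * c i)) => [|i _].
    by rewrite pE /D; field; rewrite gt_eqF.
  by rewrite M_sym.
have -> : \sum_i \sum_j M i j * c j * (x i ^+ 2 / c i) = \sum_i D i * (x i * x i).
  apply: eq_bigr => j _; rewrite -mulr_suml pE /D; field.
  by rewrite gt_eqF.
rewrite /N; lra.
Qed.

Let term_ge0 x i j : 0 <= M i j * (c i * c j * (x i / c i - x j / c j) ^+ 2).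
Proof.
have [<-|ij] := eqVneq i j; first by rewrite subrr expr0n !mulr0.
by rewrite mulr_ge0 ?M_ge0 // mulr_ge0 ?sqr_ge0 // ltW // mulr_gt0.
Qed.

Let N_ge0 x : 0 <= N x x.
Proof. by rewrite NE mulr_ge0 ?invr_ge0 // sumr_ge0 // => i _; apply: sumr_ge0. Qed.

(** A vanishing Dirichlet form makes [x i / c i] constant along every edge, hence constant on the
    connected graph. *)
Let N_ker x i0 : N x x = 0 -> forall i, x i = x i0 / c i0 * c i.
Proof.
move=> /eqP; rewrite NE mulf_eq0 invr_eq0 pnatr_eq0 /= psumr_eq0; last first.
  by move=> i _; apply: sumr_ge0.
move=> /allP x0 i.
pose A := [set i | x i / c i == x i0 / c i0]%SET.
have : i \in A.
  rewrite [A]M_connected ?inE //; first by apply/finset.set0Pn; exists i0; rewrite inE.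
  move=> j k; rewrite !inE => /eqP jA kA.
  have := x0 j (mem_index_enum _); rewrite psumr_eq0 // => /allP /(_ k (mem_index_enum _)) /=.
  rewrite !mulf_eq0 !(gt_eqF (c_gt0 _)) /= orbb subr_eq0 jA [_ == x k / _]eq_sym (negbTE kA) orbF.
  by move/eqP.
by rewrite inE => /eqP <-; rewrite divfK // gt_eqF.
Qed.

(** No diagonalization of [A] is needed. The hypothesis makes [D x] orthogonal to the kernel of [N],
    so [D x = N z] has a solution, and the Bochner inequality is applied to [z] rather than to
    [x]. *)
Lemma bochner_hyperbolic x : \sum_i p i * x i = 0 ->
  \sum_i \sum_j M i j * (x i * x j) <= 0.
Proof.
move=> px.
pose Nm : 'M[R]_n := \matrix_(i, j) ((i == j)%:R * D i - M i j).
have NmE (v : 'I_n -> R) k : ((\row_i v i) *m Nm) 0 k = D k * v k - \sum_j M k j * v j.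
  rewrite mxE (eq_bigr (fun i => (i == k)%:R * (D i * v i) - M k i * v i)) => [|i _].
    rewrite sumrB; congr (_ - _); rewrite (bigD1 k) //= eqxx mul1r big1 ?addr0 // => i ik.
    by rewrite (negbTE ik) mul0r.
  by rewrite !mxE (M_sym k i); ring.
have [y xy] : exists y, \row_i (D i * x i) = y *m Nm.
  apply: symmetric_image => [|v vN].
    by apply/matrixP => i j; rewrite !mxE M_sym eq_sym; case: eqP => [->|_]; rewrite ?mul0r.
  have vr : v = \row_i v 0 i by apply/rowP => i; rewrite !mxE.
  have {}vN : N (v 0) (v 0) = 0.
    rewrite /N -sumrB big1 // => i _.
    have := congr1 (fun A : 'rV_n => A 0 i) vN; rewrite {1}vr NmE mxE => h.
    rewrite (eq_bigr (fun j => v 0 i * (M i j * v 0 j))) -?mulr_sumr => [|j _]; last by ring.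
    have -> : D i * (v 0 i * v 0 i) = v 0 i * (D i * v 0 i) by ring.
    by rewrite -mulrBr h mulr0.
  apply/matrixP => a b; rewrite !mxE.
  (* Writing [v] as a multiple of [c] requires an index; if there is none, the sum is empty. *)
  case: (pickP 'I_n) => [i0 _|no]; last by rewrite big1 // => i; have := no i.
  rewrite (eq_bigr (fun i => (v 0 i0 / c i0) * (p i * x i))) -?mulr_sumr ?px ?mulr0 // => i _.
  rewrite !mxE !ord1 (N_ker i0 vN i) /D; field.
  by rewrite !gt_eqF.
pose z i := y 0 i.
have zE k : D k * x k = D k * z k - \sum_j M k j * z j.
  rewrite -NmE -[in RHS](_ : y = \row_i z i); last by apply/rowP => i; rewrite !mxE.
  by rewrite -xy mxE.
have Mz i : \sum_j M i j * z j = D i * z i - D i * x i by rewrite zE; ring.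
have D0 i : 0 < D i by rewrite divr_gt0.
(* With N = D - M, one has N(x, z) = |x|^2 and, by the Bochner inequality,
   N(z, z) <= |x|^2, so N(x - z, x - z) >= 0 gives N(x, x) >= |x|^2. *)
have bz := M_bochner z.
have := N_ge0 (fun i => x i - z i); rewrite /N.
have -> : \sum_i D i * ((x i - z i) * (x i - z i)) =
   \sum_i D i * (x i * x i) - 2 * \sum_i D i * (x i * z i) + \sum_i D i * (z i * z i).
  by rewrite mulr_sumr -sumrB -big_split; apply: eq_bigr => i _ /=; ring.
have -> : \sum_i \sum_j M i j * ((x i - z i) * (x j - z j)) =
   \sum_i \sum_j M i j * (x i * x j) - 2 * (\sum_i x i * \sum_j M i j * z j)
   + \sum_i \sum_j M i j * (z i * z j).
  have -> : 2 * (\sum_i x i * \sum_j M i j * z j) =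
    \sum_i \sum_j M i j * (x i * z j) + \sum_i \sum_j M i j * (x j * z i).
    rewrite [X in _ = _ + X]exchange_big /=.
    rewrite mulr_natl mulr2n; congr (_ + _); apply: eq_bigr => i _; rewrite mulr_sumr;
      apply: eq_bigr => j _; rewrite ?(M_sym j i); ring.
  rewrite -big_split -sumrB -big_split; apply: eq_bigr => i _ /=.
  rewrite -big_split -sumrB -big_split; apply: eq_bigr => j _ /=; ring.
have E1 : \sum_i x i * (\sum_j M i j * z j) = \sum_i D i * (x i * z i) - \sum_i D i * (x i * x i).
  by rewrite -sumrB; apply: eq_bigr => i _; rewrite Mz; ring.
have E2 : \sum_i c i / p i * (\sum_j M i j * z j) ^+ 2 =
  \sum_i D i * (z i * z i) - 2 * \sum_i D i * (x i * z i) + \sum_i D i * (x i * x i).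
  rewrite mulr_sumr -sumrB -big_split; apply: eq_bigr => i _ /=; rewrite Mz /D; field.
  by rewrite !gt_eqF.
have E3 : \sum_i \sum_j M i j * (z i * z j) =
  \sum_i D i * (z i * z i) - \sum_i D i * (x i * z i).
  rewrite -sumrB; apply: eq_bigr => i _.
  rewrite (eq_bigr (fun j => z i * (M i j * z j))) -?mulr_sumr ?Mz; first by ring.
  by move=> j _; ring.
by rewrite E1 E3; rewrite E2 E3 in bz; lra.
Qed.

End Bochner.

(** The last hypothesis is the value of the form at Q(x,m) b - Q(b,m) x, a vector orthogonal to m.
    Multiplied by [qbb], it bounds [qbm ^+ 2] times the wanted difference below by the square of
    [qxm * qbb - qbm * qxb]. *)
Lemma hyperbolic_reverse_CS (R : realFieldType) (qxx qxb qbb qxm qbm : R) :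
  0 < qbm -> 0 <= qbb ->
  qxm ^+ 2 * qbb - 2 * qxm * qbm * qxb + qbm ^+ 2 * qxx <= 0 ->
  qxx * qbb <= qxb ^+ 2.
Proof.
move=> m0 b0 H.
have := sqr_ge0 (qxm * qbb - qbm * qxb) => h.
rewrite -(ler_pM2l (exprn_gt0 2 m0)); nra.
Qed.

(** * Piecewise linear functions and the degree one part of the Chow ring *)

Section Homogeneous.
Variables (R : realType) (V : vectType R).

Lemma homogeneous0_cst (f : V -> R) : homogeneous 0 f -> forall v, f v = f 0.
Proof.
case=> p p0 fp v; rewrite !fp /peval !big_seq; apply: eq_bigr => t /(allP p0).
by rewrite size_eq0 => /eqP ->; rewrite !big_nil.
Qed.

Lemma homogeneous1_lin (f : V -> R) : homogeneous 1 f ->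
  exists L : 'Hom(V, R^o), forall v, f v = L v.
Proof.
case=> p p1 fp; exists (\sum_(t <- p) t.1 *: nth 0 t.2 0) => v.
rewrite fp /peval sum_lfunE big_seq [RHS]big_seq; apply: eq_bigr => t /(allP p1).
by case: t => a [|l []] //= _; rewrite big_seq1 scale_lfunE.
Qed.

Lemma homogeneous_cst c : homogeneous 0 (fun=> c : R) (V := V).
Proof. by exists [:: (c, [::])] => // v; rewrite /peval big_seq1 big_nil mulr1. Qed.

Lemma homogeneousD k (f g : V -> R) : homogeneous k f -> homogeneous k g ->
  homogeneous k (fun v => f v + g v).
Proof.
move=> [p pk fp] [q qk gq]; exists (p ++ q) => [|v]; first by rewrite all_cat pk.
by rewrite fp gq /peval big_cat.
Qed.

Lemma homogeneousM j k (f g : V -> R) : homogeneous j f -> homogeneous k g ->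
  homogeneous (j + k) (fun v => f v * g v).
Proof.
move=> [p pj fp] [q qk gq].
exists [seq (t.1 * u.1, t.2 ++ u.2) | t <- p, u <- q] => [|v].
  apply/allP => _ /allpairsP[[t u] /= [/(allP pj) /eqP tj /(allP qk) /eqP uk ->]] /=.
  by rewrite size_cat tj uk.
rewrite /peval big_allpairs_dep /= fp gq mulr_suml; apply: eq_bigr => t _.
by rewrite mulr_sumr; apply: eq_bigr => u _; rewrite big_cat mulrACA.
Qed.

Lemma polynomial_comp (W : vectType R) (h : 'Hom(W, V)) (f : V -> R) :
  Defs.polynomial f -> Defs.polynomial (fun w => f (h w)).
Proof.
case=> p fp; exists [seq (t.1, [seq (l \o h)%VF | l <- t.2]) | t <- p] => w.
rewrite fp /peval big_map; apply: eq_bigr => t _ /=; rewrite big_map; congr (_ * _).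
by apply: eq_bigr => l _; rewrite comp_lfunE.
Qed.

(** Along the line through [v] each functional [l] becomes [l v] times the variable, so linear terms
    can be read off as coefficients. *)
Lemma peval_ray p (v : V) : {P : {poly R} | forall t, peval p (t *: v) = P.[t]}.
Proof.
exists (\sum_(t <- p) t.1 *: \prod_(l <- t.2) ((l v : R) *: 'X)) => t.
rewrite /peval horner_sum; apply: eq_bigr => u _; rewrite hornerZ; congr (_ * _).
rewrite horner_prod; apply: eq_bigr => l _.
by rewrite hornerZ hornerX linearZ /= mulrC.
Qed.

End Homogeneous.

Section PiecewiseLinearClasses.
Variables (R : realType) (V : vectType R) (F : fan V).
Implicit Types (S : {set ray F}) (f g : ppoly F) (x : supportT F) (a : ray F -> R).

Lemma cone_supportT S a : S \in cones F -> (forall i, 0 <= a i) ->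
  exists x, val x = \sum_(i in S) a i *: gen i.
Proof.
move=> Sc a0.
have vS : \sum_(i in S) a i *: gen i \in Defs.support F.
  by apply/mem_set; exists S => //; exists a.
by exists (SigSub vS).
Qed.

Lemma supportTP x : exists S a,
  [/\ S \in cones F, forall i, 0 <= a i & val x = \sum_(i in S) a i *: gen i].
Proof. by have /set_mem[S Sc [a a0 xa]] := valP x; exists S, a. Qed.

Lemma gen_support (i : ray F) : gen i \in Defs.support F.
Proof.
apply/mem_set; exists [set i]%SET; first exact: cones1.
by exists (fun=> 1) => //; rewrite big_set1 scale1r.
Qed.

Definition gen_pt (i : ray F) : supportT F := SigSub (gen_support i).

(** The linear function representing [f] varies with the cone, but at the rays of a cone it takes
    the values of [f]. *)
Lemma pp_hom1E f S a x : pp_hom 1 f -> S \in cones F -> (forall i, 0 <= a i) ->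
  val x = \sum_(i in S) a i *: gen i -> f x = \sum_(i in S) a i * f (gen_pt i).
Proof.
move=> fh Sc a0 xa; have [p /homogeneous1_lin[L pL] fp] := fh S Sc.
rewrite fp ?pL; last by exists a.
rewrite xa linear_sum; apply: eq_bigr => i iS; rewrite linearZ fp ?pL //.
exists (fun j => (i == j)%:R) => [j|]; first by rewrite ler0n.
rewrite (bigD1 i) //= eqxx scale1r big1 ?addr0 // => j /andP[_ /negbTE ji].
by rewrite eq_sym ji scale0r.
Qed.

Lemma pp_hom1Z f x y t : pp_hom 1 f -> 0 <= t -> val y = t *: val x -> f y = t * f x.
Proof.
move=> fh t0 yx; have [S [a [Sc a0 xa]]] := supportTP x.
rewrite (pp_hom1E fh Sc a0 xa) (pp_hom1E (a := fun i => t * a i) fh Sc).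
- by rewrite mulr_sumr; apply: eq_bigr => i _; rewrite mulrA.
- by move=> i; rewrite mulr_ge0.
- by rewrite yx xa scaler_sumr; apply: eq_bigr => i _; rewrite scalerA.
Qed.

Lemma pp_sumE (I : Type) (r : seq I) (P : pred I) (h : I -> ppoly F) x :
  (\sum_(i <- r | P i) h i) x = \sum_(i <- r | P i) h i x.
Proof. exact: (big_morph (fun f : ppoly F => f x)). Qed.

Lemma ppP f g : (forall x, f x = g x) -> f = g.
Proof. by move=> fg; apply: val_inj; apply/funext. Qed.

Lemma clsB f g : cls (f - g) = cls f - cls g.
Proof. by apply/(canRL (addrK _)); rewrite -clsD subrK. Qed.

Lemma cls0 : cls (0 : ppoly F) = 0.
Proof. by rewrite -(subrr 0) clsB subrr. Qed.

Lemma cls_sum (I : Type) (r : seq I) (P : pred I) (h : I -> ppoly F) :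
  cls (\sum_(i <- r | P i) h i) = \sum_(i <- r | P i) cls (h i).
Proof. exact: (big_morph _ (@clsD _ _ F) cls0). Qed.

Lemma cls_ideal f : pp_lin_ideal f -> cls f = 0.
Proof. by move=> f0; rewrite -cls0; apply/cls_eq; rewrite subr0. Qed.

Lemma clsZ (c : R) f : c *: cls f = cls (pp_cst F c * f).
Proof. by rewrite clsM. Qed.

Lemma chow_scaleAr (c : R) (x y : chow F) : x * (c *: y) = c *: (x * y).
Proof. by rewrite mulrC -scalerAl mulrC. Qed.

Lemma courantE i S a x : S \in cones F -> (forall i, 0 <= a i) ->
  val x = \sum_(i in S) a i *: gen i -> courant i x = (i \in S)%:R * a i.
Proof.
move=> Sc a0 xa; rewrite -[LHS]/(pl_fun _ x) (pl_funE _ Sc a0 xa).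
have [iS|iS] := boolP (i \in S); last first.
  by rewrite mul0r big1 // => j jS; rewrite eq_sym (negbTE (memPn iS _ jS)) mulr0.
rewrite (bigD1 i) //= eqxx mulr1 mul1r big1 ?addr0 // => j /andP[_ ji].
by rewrite eq_sym (negbTE ji) mulr0.
Qed.

Definition divisor (i : ray F) : chow F := cls (courant i).

Lemma pp_hom1_cls f : pp_hom 1 f -> cls f = \sum_i f (gen_pt i) *: divisor i.
Proof.
move=> fh; under [RHS]eq_bigr do rewrite clsZ.
rewrite -cls_sum; congr cls; apply: ppP => x.
have [S [a [Sc a0 xa]]] := supportTP x.
rewrite (pp_hom1E fh Sc a0 xa) pp_sumE big_mkcond; apply: eq_bigr => i _.
rewrite -[RHS]/(f (gen_pt i) * courant i x) (courantE _ Sc a0 xa).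
by case: (i \in S); rewrite ?mul0r ?mulr0 // mul1r mulrC.
Qed.

Lemma pl_hom (c : ray F -> R) : pp_hom 1 (pl c).
Proof. exact: pl_fun_piecewise. Qed.

Lemma pl_gen (c : ray F -> R) i : pl c (gen_pt i) = c i.
Proof.
rewrite -[LHS]/(pl_fun _ _) (pl_funE (a := fun=> 1) _ (cones1 i)) ?big_set1 ?mul1r //.
by rewrite scale1r.
Qed.

Lemma pl_cls (c : ray F -> R) : cls (pl c) = \sum_i c i *: divisor i.
Proof.
by rewrite (pp_hom1_cls (pl_hom c)); apply: eq_bigr => i _; rewrite pl_gen.
Qed.

Lemma chow_deg1P (x : chow F) :
  chow_deg 1 x <-> exists c : ray F -> R, x = \sum_i c i *: divisor i.
Proof.
split=> [[f fh ->]|[c ->]]; first by rewrite pp_hom1_cls //; eexists.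
by exists (pl c); rewrite ?pl_cls //; exact: pl_hom.
Qed.

Lemma chow_deg1_0 : chow_deg 1 (0 : chow F).
Proof.
by apply/chow_deg1P; exists (fun=> 0); rewrite big1 // => i _; rewrite scale0r.
Qed.

Lemma pp_lin_cls (L : 'Hom(V, R^o)) : cls (pp_lin F L) = 0.
Proof.
by apply: cls_ideal; apply/asboolP; exists [:: (L, 1)]; rewrite big_seq1 mulr1.
Qed.

Lemma pp_lin_hom (L : 'Hom(V, R^o)) : pp_hom 1 (pp_lin F L).
Proof. by move=> S _; exists L => //; exact: homogeneous_lin. Qed.

Lemma divisor_linear (L : 'Hom(V, R^o)) : \sum_i (L (gen i) : R) *: divisor i = 0.
Proof. by rewrite -[RHS](pp_lin_cls L) (pp_hom1_cls (pp_lin_hom L)). Qed.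

(** Stanley-Reisner relation: on every cone one of the two Courant functions vanishes
    identically. *)
Lemma divisorM0 i j : [set i; j]%SET \notin cones F -> divisor i * divisor j = 0.
Proof.
move=> ijc; rewrite -clsM -cls0; congr cls; apply: ppP => x.
have [S [a [Sc a0 xa]]] := supportTP x.
rewrite -[LHS]/(courant i x * courant j x) !(courantE _ Sc a0 xa).
have [iS|] := boolP (i \in S); last by rewrite !mul0r.
have [jS|] := boolP (j \in S); last by rewrite mul0r mulr0.
by move: ijc; rewrite (cones_face _ Sc) // finset.subUset !finset.sub1set iS.
Qed.

Lemma chow_degD k (x y : chow F) : chow_deg k x -> chow_deg k y -> chow_deg k (x + y).
Proof.
move=> [f fh ->] [g gh ->]; exists (f + g); last by rewrite clsD.
move=> S Sc; have [p ph fp] := fh S Sc; have [q qh gq] := gh S Sc.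
exists (fun v => p v + q v); first exact: homogeneousD.
by move=> u uS; rewrite -fp // -gq.
Qed.

Lemma chow_degM j k (x y : chow F) :
  chow_deg j x -> chow_deg k y -> chow_deg (j + k) (x * y).
Proof.
move=> [f fh ->] [g gh ->]; exists (f * g); last by rewrite clsM.
move=> S Sc; have [p ph fp] := fh S Sc; have [q qh gq] := gh S Sc.
exists (fun v => p v * q v); first exact: homogeneousM.
by move=> u uS; rewrite -fp // -gq.
Qed.

Lemma chow_deg_cst (c : R) : chow_deg 0 (cls (pp_cst F c)).
Proof. by exists (pp_cst F c) => // S _; exists (fun=> c) => //; exact: homogeneous_cst. Qed.

Lemma chow_degZ k c (x : chow F) : chow_deg k x -> chow_deg k (c *: x).
Proof. by move=> xk; rewrite -[k]add0n; apply: chow_degM => //; exact: chow_deg_cst. Qed.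

Lemma chow_degB k (x y : chow F) : chow_deg k x -> chow_deg k y -> chow_deg k (x - y).
Proof. by move=> xk yk; rewrite -scaleN1r; apply: chow_degD => //; exact: chow_degZ. Qed.

Lemma chow_deg_1 : chow_deg 0 (1 : chow F).
Proof. by rewrite -cls1 -pp_cst1; exact: chow_deg_cst. Qed.

Lemma chow_deg_divisor i : chow_deg 1 (divisor i).
Proof. by exists (courant i) => //; exact: pl_hom. Qed.

Lemma chow_deg_prod (s : seq (chow F)) :
  {in s, forall y, chow_deg 1 y} -> chow_deg (size s) (\prod_(y <- s) y).
Proof.
elim: s => [|y s IH] s1; first by rewrite big_nil; exact: chow_deg_1.
rewrite big_cons /= -add1n; apply: chow_degM; first by apply: s1; rewrite mem_head.
by apply: IH => z zs; apply: s1; rewrite inE zs orbT.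
Qed.

(** A piecewise constant function is constant because all cones share the origin. *)
Lemma chow_deg0P (x : chow F) : chow_deg 0 x -> exists c : R, x = c *: 1.
Proof.
case=> f fh ->; exists (f point); rewrite -cls1 clsZ mulr1; congr cls; apply: ppP => u.
have [S [a [Sc a0 xa]]] := supportTP u.
have [p ph fp] := fh S Sc.
rewrite -[RHS]/(f point) !fp; last first.
- by exists a.
- by exists (fun=> 0) => //; rewrite big1 // => i _; rewrite scale0r.
by rewrite homogeneous0_cst // [RHS]homogeneous0_cst.
Qed.

(** In top degree the complementary piece consists of scalars, so the pairing is the degree
    itself. *)
Lemma poincare_top d (deg : {scalar chow F}) (x : chow F) :
  poincare_duality d deg -> chow_deg d x -> deg x = 0 -> x = 0.
Proof.
move=> pd xd x0; apply: (pd d (leqnn d)).1 => // y.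
by rewrite subnn => /chow_deg0P[c ->]; rewrite chow_scaleAr mulr1 linearZ /= x0 mulr0.
Qed.

End PiecewiseLinearClasses.

(** * Restriction to stars *)

Section LinearIdeal.
Variables (R : realType) (V : vectType R) (F : fan V).
Implicit Types f g a : ppoly F.

Lemma lin_idealDM a f g :
  pp_lin_ideal f -> pp_lin_ideal g -> pp_lin_ideal (a * f + g).
Proof. by have [_ _] := pp_lin_ideal_closed F; apply. Qed.

Lemma lin_ideal0 : pp_lin_ideal (0 : ppoly F).
Proof. by have [] := pp_lin_ideal_closed F. Qed.

Lemma lin_idealD f g : pp_lin_ideal f -> pp_lin_ideal g -> pp_lin_ideal (f + g).
Proof. by move=> fI gI; rewrite -[f]mul1r; exact: lin_idealDM. Qed.

Lemma lin_idealM a f : pp_lin_ideal f -> pp_lin_ideal (a * f).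
Proof. by move=> fI; rewrite -[_ * _]addr0; apply: lin_idealDM; last exact: lin_ideal0. Qed.

Lemma lin_ideal_sum (I : Type) (r : seq I) (h : I -> ppoly F) :
  (forall i, pp_lin_ideal (h i)) -> pp_lin_ideal (\sum_(i <- r) h i).
Proof.
move=> hI; elim: r => [|i r IH]; first by rewrite big_nil; exact: lin_ideal0.
by rewrite big_cons; apply: lin_idealD.
Qed.

Lemma lin_ideal_lin (L : 'Hom(V, R^o)) a : pp_lin_ideal (pp_lin F L * a).
Proof. by apply/asboolP; exists [:: (L, a)]; rewrite big_seq1. Qed.

End LinearIdeal.

Section Restriction.
Variables (R : realType) (V : vectType R) (F : fan V) (s : cone_type F).
Implicit Types (S : {set ray F}) (v : supportT F) (u : supportT (star s)).

Definition agree_on_star (f h : ppoly F) (g : ppoly (star s)) : Prop :=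
  forall S v u, S \in cones F -> (val s \subset S)%B ->
    poshull (@gen _ _ F) S (val v) -> val u = starpi s (val v) -> f v = g u + h v.

(** Packing the list of linear terms into one element [h] of the ideal reduces compatibility with
    sums and products to ring identities. *)
Lemma star_restrictionP (x : chow F) (y : chow (star s)) :
  star_restriction x y <-> exists f g h,
    [/\ x = cls f, y = cls g, pp_lin_ideal h & agree_on_star f h g].
Proof.
split=> [[f [g [r [-> -> fg]]]]|[f [g [h [-> -> /asboolP[r hr] fg]]]]].
  exists f, g, (\sum_(t <- r) pp_lin F t.1 * t.2); split=> //.
    by apply/asboolP; exists r.
  by move=> S v u Sc sS vS uv; rewrite (fg S v u) // pp_sumE.
exists f, g, r; split=> // S v u Sc sS vS uv.
by rewrite (fg S v u) // hr pp_sumE.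
Qed.

Lemma star_restrictionD x1 y1 x2 y2 :
  star_restriction x1 y1 -> star_restriction x2 y2 ->
  star_restriction (s := s) (x1 + x2) (y1 + y2).
Proof.
move=> /star_restrictionP[f [g [h [-> -> hI fg]]]].
move=> /star_restrictionP[f' [g' [h' [-> -> hI' fg']]]].
apply/star_restrictionP; exists (f + f'), (g + g'), (h + h').
split; rewrite ?clsD //; first exact: lin_idealD.
move=> S v u Sc sS vS uv.
rewrite -[LHS]/(f v + f' v) -[RHS]/(g u + g' u + (h v + h' v)).
by rewrite (fg S v u) // (fg' S v u) // addrACA.
Qed.

Lemma star_restrictionM x1 y1 x2 y2 :
  star_restriction x1 y1 -> star_restriction x2 y2 ->
  star_restriction (s := s) (x1 * x2) (y1 * y2).
Proof.
move=> /star_restrictionP[f [g [h [-> -> hI fg]]]].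
move=> /star_restrictionP[f' [g' [h' [-> -> hI' fg']]]].
(* On the cones containing [s] one has f = g + h and f' = g' + h', hence f f' - g g' = g h' + f' h.
   Here g is written as f - h, since it lives on the star and not on [F]. *)
apply/star_restrictionP; exists (f * f'), (g * g'), ((f - h) * h' + f' * h).
split; rewrite ?clsM //.
  by apply: lin_idealDM => //; exact: lin_idealM.
move=> S v u Sc sS vS uv.
rewrite -[LHS]/(f v * f' v) -[RHS]/(g u * g' u + ((f v - h v) * h' v + f' v * h v)).
by rewrite (fg S v u) // (fg' S v u) //; ring.
Qed.

Lemma star_restriction_cst (c : R) :
  star_restriction (s := s) (cls (pp_cst F c)) (cls (pp_cst _ c)).
Proof.
apply/star_restrictionP; exists (pp_cst F c), (pp_cst _ c), 0; split=> //.
  exact: lin_ideal0.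
by move=> S v u _ _ _ _; rewrite -[RHS]/(c + 0) addr0.
Qed.

Lemma star_restrictionZ c x y :
  star_restriction x y -> star_restriction (s := s) (c *: x) (c *: y).
Proof. by apply: star_restrictionM; exact: star_restriction_cst. Qed.

Lemma star_restriction1 : star_restriction (s := s) 1 1.
Proof. by rewrite -!cls1 -!pp_cst1; exact: star_restriction_cst. Qed.

Lemma star_restriction0 : star_restriction (s := s) 0 0.
Proof. by have := star_restrictionZ 0 star_restriction1; rewrite !scale0r. Qed.

Lemma star_restriction_prod (I : finType) (P : pred I) (x : I -> chow F)
    (y : I -> chow (star s)) : (forall i, P i -> star_restriction (x i) (y i)) ->
  star_restriction (\prod_(i | P i) x i) (\prod_(i | P i) y i).
Proof.
move=> xy; apply: (big_ind2 (fun a b => star_restriction a b)) => //.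
- exact: star_restriction1.
- by move=> *; exact: star_restrictionM.
Qed.

Lemma big_star_join (T : Type) (idx : T) (op : Monoid.com_law idx)
    (S : {set star_ray s}) (a : ray F -> T) :
  \big[op/idx]_(i in star_join S) a i =
  op (\big[op/idx]_(i in S) a (val i)) (\big[op/idx]_(i in val s) a i).
Proof.
have dis : [disjoint [set val i | i in S]%SET & val s]%B.
  rewrite disjoint_subset; apply/fintype.subsetP => _ /imsetP[i _ ->].
  exact: star_notin.
rewrite (eq_bigl _ _ (fun i => finset.in_setU i _ _)) bigU //=; congr (op _ _).
by rewrite big_imset //= => i j _ _ /val_inj.
Qed.

Definition star_cut S : {set star_ray s} := [set j | val j \in S]%SET.

Lemma star_cutK S : S \in cones F -> (val s \subset S)%B -> star_join (star_cut S) = S.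
Proof.
move=> Sc sS; apply/finset.setP => i; rewrite finset.in_setU.
have [is_|is_] := boolP (i \in val s); first by rewrite orbT (fintype.subsetP sS).
rewrite orbF; apply/imsetP/idP => [[j + ->]|iS]; first by rewrite inE.
have iP : (i \notin val s) && ((i |: val s)%SET \in cones F).
  by rewrite is_ (cones_face _ Sc) // finset.subUset finset.sub1set iS.
by exists (Sub i iP); rewrite ?inE.
Qed.

Lemma starpi_gen0 i : i \in val s -> starpi s (gen i) = 0.
Proof.
move=> si; apply/eqP; rewrite -memv_ker lker_quotpi; apply/memv_span/mapP.
by exists i => //; rewrite mem_enum.
Qed.

(** The image of a primitive generator need not be primitive in the quotient lattice; [k j] is the
    correcting factor. *)
Variable k : star_ray s -> R.
Hypothesis kP : forall j, 0 < k j /\ star_gen j = k j *: starpi s (gen (val j)).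

Lemma starpi_sum S a : S \in cones F -> (val s \subset S)%B ->
  starpi s (\sum_(i in S) a i *: gen i) =
  \sum_(j in star_cut S) (a (val j) / k j) *: star_gen j.
Proof.
move=> Sc sS; rewrite -{1}(star_cutK Sc sS) big_star_join linearD /= !linear_sum /=.
rewrite [X in _ + X]big1 => [|i is_]; last by rewrite linearZ /= starpi_gen0 ?scaler0.
rewrite addr0; apply: eq_bigr => j _; rewrite linearZ /= (kP j).2.
by rewrite scalerA divfK // gt_eqF // (kP j).1.
Qed.

Lemma star_hom1E g S a v u : pp_hom 1 g -> S \in cones F -> (val s \subset S)%B ->
  (forall i, 0 <= a i) -> val v = \sum_(i in S) a i *: gen i ->
  val u = starpi s (val v) ->
  g u = \sum_(j in star_cut S) a (val j) / k j * g (gen_pt (F := star s) j).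
Proof.
move=> gh Sc sS a0 va uv.
apply: (@pp_hom1E _ _ (star s) g (star_cut S) (fun j : star_ray s => a (val j) / k j) u) => //.
- by rewrite inE star_cutK.
- by move=> j; rewrite divr_ge0 // ltW // (kP j).1.
- by rewrite uv va starpi_sum.
Qed.

(** The generator of the ray maps to the primitive generator divided by [k j]; the factor [k j]
    restores the value 1 there, and no linear correction is needed. *)
Lemma star_restriction_divisor (j : star_ray s) :
  star_restriction (divisor (val j)) (k j *: divisor (F := star s) j).
Proof.
apply/star_restrictionP; exists (courant (val j)), (pp_cst _ (k j) * courant (F := star s) j), 0.
split=> //; [by rewrite clsM|exact: lin_ideal0|] => S v u Sc sS [a a0 va] uv.
rewrite (courantE _ Sc a0 va) -[RHS]/(k j * courant (F := star s) j u + 0) addr0.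
have ch : pp_hom 1 (courant (F := star s) j) by exact: pl_hom.
rewrite (star_hom1E ch Sc sS a0 va uv).
have cj i : courant (F := star s) j (gen_pt (F := star s) i) = (j == i)%:R.
  by rewrite /courant pl_gen.
have k0 := gt_eqF (kP j).1.
have [jS|jS] := boolP (val j \in S).
  rewrite (bigD1 j) ?inE // cj eqxx big1 => [|i /andP[_ ij]].
    by rewrite Monoid.mulm1 mulr1 mul1r mulrC divfK ?k0.
  by rewrite cj eq_sym (negbTE ij) mulr0.
rewrite mul0r big1 ?mulr0 // => i; rewrite inE => iS.
by rewrite cj [j == i](_ : _ = false) ?mulr0 //; apply: contraNF jS => /eqP ->.
Qed.

Lemma star_restriction_divisor0 (i : ray F) : i \notin val s ->
  (i |: val s)%SET \notin cones F -> star_restriction (s := s) (divisor i) 0.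
Proof.
move=> is_ iS; apply/star_restrictionP; exists (courant i), 0, 0.
split; rewrite ?cls0 //; first exact: lin_ideal0.
move=> S v u Sc sS [a a0 va] uv; rewrite (courantE _ Sc a0 va).
rewrite -[RHS]/(0 + 0 : R) addr0 (_ : i \in S = false) ?mul0r //.
by apply: contraNF iS => iS; rewrite (cones_face _ Sc) // finset.subUset finset.sub1set iS.
Qed.

End Restriction.

(** * The star of a ray: extension and restriction of classes *)

Section RayStar.
Variables (R : realType) (V : vectType R) (F : fan V).
Implicit Types (S : {set ray F}) (v : supportT F).

Lemma starpi_poshull (s : cone_type F) S (v : V) : S \in cones F ->
  (val s \subset S)%B -> poshull (@gen _ _ F) S v ->
  star_cut s S \in cones (star s) /\
  poshull (@gen _ _ (star s)) (star_cut s S) (starpi s v).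
Proof.
move=> Sc sS [a a0 ->]; have [k kP] := star_genE s.
split; first by rewrite inE star_cutK.
rewrite (starpi_sum kP) //; exists (fun j : star_ray s => a (val j) / k j) => // j.
by rewrite divr_ge0 // ltW // (kP j).1.
Qed.

Definition ray_cone (i : ray F) : cone_type F := Sub [set i]%SET (cones1 i).

Variable i : ray F.
Let s := ray_cone i.

(** The default, the origin, is taken only where the projection of [v] leaves the support of the
    star; [v] then lies on no cone containing [i], so the Courant function of [i] vanishes at
    [v]. *)
Definition star_pt v : supportT (star s) := 
  insubd (SigSub (support0 (star s))) (starpi s (val v)).

Lemma star_ptE v S : S \in cones F -> i \in S -> poshull (@gen _ _ F) S (val v) ->
  val (star_pt v) = starpi s (val v).
Proof.
move=> Sc iS vS; rewrite val_insubd ifT //; apply/mem_set.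
have sS : (val s \subset S)%B by rewrite finset.sub1set.
by have [] := starpi_poshull Sc sS vS; exists (star_cut s S).
Qed.

Lemma poshull_subset S (T : {set ray F}) (v : V) : (S \subset T)%B ->
  poshull (@gen _ _ F) S v -> poshull (@gen _ _ F) T v.
Proof.
move=> ST [a a0 ->]; exists (fun j => if j \in S then a j else 0).
  by move=> j; case: ifP.
rewrite [RHS](bigID (mem S)) /= [X in _ + X]big1 => [|j /andP[_ /negbTE ->]].
  rewrite addr0; apply: eq_big => [j|j ->] //.
  by rewrite andb_idl // => /(fintype.subsetP ST).
by rewrite scale0r.
Qed.

(* A function on the star extends to the fan once multiplied by the Courant
   function of i, which vanishes on the cones that do not span a cone with i. *)
Lemma courant_extension_subproof (g : ppoly (star s)) :
  (fun v => courant i v * g (star_pt v)) \in @pp_pred R V F.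
Proof.
apply/asboolP => S Sc.
have [iSc|iSc] := boolP ((i |: S)%SET \in cones F); last first.
  exists (fun=> 0); first exact: polynomial_cst.
  move=> v [a a0 va]; rewrite (courantE _ Sc a0 va) (_ : i \in S = false) ?mul0r //.
  by apply: contraNF iSc => iS; rewrite (finset.setUidPr _) ?finset.sub1set.
(* [S] may omit [i], so the polynomial is built on the larger cone [i |: S], whose image is a cone
   of the star. *)
have iS : i \in (i |: S)%SET by rewrite !inE eqxx.
have sS : (val s \subset i |: S)%SET%B by rewrite finset.sub1set.
have [p ph fp] := pl_hom (fun j => (i == j)%:R) iSc.
have cutc : star_cut s (i |: S) \in cones (star s) by rewrite inE star_cutK.
have /asboolP/(_ _ cutc)[q qp gq] := ppfunP g.
exists (fun u : V => p u * q (starpi s u)).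
  by apply: polynomialM; [exact: homogeneous_polynomial ph|exact: polynomial_comp].
move=> v vS; have {}vS := poshull_subset (finset.subsetU1 i _) vS.
rewrite -fp // -(star_ptE iSc) // -gq // (star_ptE iSc) //.
by have [] := starpi_poshull iSc sS vS.
Qed.

Definition courant_extension (g : ppoly (star s)) : ppoly F :=
  PPoly (courant_extension_subproof g).

(** Multiplication by the class of [i] factors through restriction to its star. A relation on the
    star pulls back to linear functions on [V] whose coefficients, multiplied by the Courant
    function, extend to the whole fan; off the star both sides vanish. *)
Lemma divisor_star0 x : star_restriction (s := s) x 0 -> divisor i * x = 0.
Proof.
move=> /star_restrictionP[f [g [h [-> /esym g0 hI fg]]]].
have /asboolP[r gr] : pp_lin_ideal g.
  by rewrite -(subr0 g); apply/cls_eq; rewrite cls0.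
rewrite -clsM; apply: cls_ideal.
have -> : courant i * f = \sum_(t <- r) pp_lin F (t.1 \o starpi s)%VF * courant_extension t.2
    + courant i * h.
  apply: ppP => v; have [S [a [Sc a0 va]]] := supportTP v.
  rewrite -[LHS]/(courant i v * f v).
  rewrite -[RHS]/((\sum_(t <- r) pp_lin F (t.1 \o starpi s)%VF * courant_extension t.2) v
     + courant i v * h v) pp_sumE.
  rewrite (eq_bigr (fun t : 'Hom(starV s, R^o) * ppoly (star s) =>
    courant i v * (t.1 (starpi s (val v)) * t.2 (star_pt v)))); last first.
    move=> t _; rewrite -[LHS]/((t.1 \o starpi s)%VF (val v) * (courant i v * t.2 (star_pt v))).
    by rewrite comp_lfunE mulrCA.
  rewrite -mulr_sumr -mulrDr.
  have [iS|iS] := boolP (i \in S); last first.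
    by rewrite (courantE _ Sc a0 va) (negbTE iS) !mul0r.
  have vS : poshull (@gen _ _ F) S (val v) by exists a.
  have pE := star_ptE Sc iS vS.
  rewrite (fg S v (star_pt v)) ?finset.sub1set // gr pp_sumE; congr (_ * (_ + _)).
  by apply: eq_bigr => t _; rewrite -pE.
apply: lin_idealD; last exact: lin_idealM.
by apply: lin_ideal_sum => t; exact: lin_ideal_lin.
Qed.

Lemma dual_gen : exists L : 'Hom(V, R^o), L (gen i) = 1.
Proof.
have [L LE] := linear_of_free [:: gen i] [:: 1 : R^o].
exists (linfun L); rewrite lfunE /=.
by have [] : [seq L u | u <- [:: gen i]] = [:: 1 : R^o]
  by apply: LE; rewrite ?seq1_free ?gen_neq0.
Qed.

(** The classes of the other rays restrict directly. The class of [i] itself is first eliminated by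
    the linear relation of a functional equal to 1 at [gen i]. *)
Lemma star_restriction_exists x : chow_deg 1 x ->
  exists2 y, chow_deg 1 y & star_restriction (s := s) x y.
Proof.
have [k kP] := star_genE s.
have other j : j != i -> exists2 y, chow_deg 1 y & star_restriction (s := s) (divisor j) y.
  move=> ji; have js : j \notin val s by rewrite inE.
  have [jc|jc] := boolP ((j |: val s)%SET \in cones F); last first.
    exists 0; last exact: star_restriction_divisor0.
    exact: chow_deg1_0.
  have jP : (j \notin val s) && ((j |: val s)%SET \in cones F) by rewrite js.
  exists (k (Sub j jP) *: divisor (F := star s) (Sub j jP)).
    by apply: chow_degZ; exact: chow_deg_divisor.
  exact: (star_restriction_divisor kP (Sub j jP)).
have sums (c : ray F -> R) : exists2 y, chow_deg 1 y &
    star_restriction (s := s) (\sum_(j | j != i) c j *: divisor j) y.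
  apply: (big_ind (fun x => exists2 y, chow_deg 1 y & star_restriction (s := s) x y)).
  - exists 0; last exact: star_restriction0.
    exact: chow_deg1_0.
  - move=> a b [a' a1 aa'] [b' b1 bb']; exists (a' + b'); first exact: chow_degD.
    exact: star_restrictionD.
  - move=> j /other[y y1 jy]; exists (c j *: y); first exact: chow_degZ.
    exact: star_restrictionZ.
move=> /chow_deg1P[c ->].
have [L Li] := dual_gen.
have -> : \sum_j c j *: divisor j = \sum_(j | j != i) (c j - c i * (L (gen j) : R)) *: divisor j.
  transitivity (\sum_j c j *: divisor j - c i *: \sum_j (L (gen j) : R) *: divisor j).
    by rewrite divisor_linear scaler0 subr0.
  rewrite scaler_sumr -sumrB (bigD1 i) //= Li scale1r subrr add0r.
  by apply: eq_bigr => j _; rewrite scalerBl scalerA.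
exact: sums.
Qed.

End RayStar.

(** * Ample classes *)

Section LinearPart.
Variables (R : realType).

(** The support is stable under nonnegative scalings only, so polynomials along a ray are compared
    at natural numbers. *)
Lemma poly_eq_nat (p q : {poly R}) : (forall n : nat, p.[n%:R] = q.[n%:R]) -> p = q.
Proof.
move=> pq; apply/eqP; rewrite -subr_eq0; apply/negPn/negP => pq0.
have := max_poly_roots (rs := [seq n%:R | n <- iota 0 (size (p - q))]) pq0.
rewrite size_map size_iota ltnn => /(_ _ _)/negP; apply=> //.
  by apply/allP => _ /mapP[n _ ->]; rewrite rootE hornerD hornerN pq subrr.
by rewrite map_inj_uniq ?iota_uniq // => m n /eqP; rewrite eqr_nat => /eqP.
Qed.

Variables (V : vectType R) (F : fan V).
Implicit Types (S : {set ray F}) (f : ppoly F) (v : supportT F).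

Lemma supportTZ v (t : R) : 0 <= t -> exists v', val v' = t *: val v.
Proof.
move=> t0; have [S [a [Sc a0 ->]]] := supportTP v.
have [|v' v'E] := cone_supportT (a := fun i => t * a i) Sc.
  by move=> i; rewrite mulr_ge0.
by exists v'; rewrite v'E scaler_sumr; apply: eq_bigr => i _; rewrite scalerA.
Qed.

Lemma pp_hom1_0 f v : pp_hom 1 f -> val v = 0 -> f v = 0.
Proof.
by move=> fh v0; rewrite (pp_hom1Z (x := v) (t := 0) fh) ?mul0r // scale0r.
Qed.

Lemma pp_on_ray f v : exists2 P : {poly R}, P`_0 = f point &
  forall (n : nat) v', val v' = n%:R *: val v -> f v' = P.[n%:R].
Proof.
have [S [a [Sc a0 va]]] := supportTP v.
have /asboolP/(_ S Sc)[p [q pq] fp] := ppfunP f.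
have [P PE] := peval_ray q (val v).
have fP (n : nat) v' : val v' = n%:R *: val v -> f v' = P.[n%:R].
  move=> v'E; rewrite fp; last first.
    exists (fun i => n%:R * a i) => [i|]; first by rewrite mulr_ge0.
    by rewrite v'E va scaler_sumr; apply: eq_bigr => i _; rewrite scalerA.
  by rewrite pq v'E PE.
exists P => //; rewrite -horner_coef0 -(fP 0 point) //.
by rewrite scale0r.
Qed.

(** In a product of a linear functional l and a function f, only the value of f at the origin
    contributes to the linear term along a ray. The sum of the f(0) l is thus one functional valid
    on all rays. *)
Lemma lin_ideal_linear_part h : pp_lin_ideal h -> exists L : 'Hom(V, R^o),
  forall v, exists2 P : {poly R}, P`_1 = L (val v) &
    forall (n : nat) v', val v' = n%:R *: val v -> h v' = P.[n%:R].
Proof.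
move=> /asboolP[r ->]; elim: r => [|[l f] r [L LP]].
  exists 0 => v; exists 0; first by rewrite coef0 zero_lfunE.
  by move=> n v' _; rewrite big_nil horner0.
exists (f point *: l + L) => v.
have [P P1 PE] := LP v; have [Q Q0 QE] := pp_on_ray f v.
exists (((l (val v) : R) *: 'X) * Q + P).
  by rewrite coefD P1 -scalerAl coefZ coefXM /= Q0 add_lfunE scale_lfunE /= mulrC.
move=> n v' v'E; rewrite big_cons.
rewrite -[LHS]/((l (val v') : R) * f v' + (\sum_(t <- r) pp_lin F t.1 * t.2) v').
rewrite (PE n v') // (QE n v') // hornerD hornerM hornerZ hornerX v'E linearZ /=.
by rewrite [_ * n%:R]mulrC.
Qed.

End LinearPart.

Section Ample.
Variables (R : realType) (V : vectType R) (F : fan V).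
Implicit Types (S : {set ray F}) (f : ppoly F) (v : supportT F).

(* The witnesses of a restriction may be inhomogeneous; compare the coefficients
   of t along the ray t |-> t v. *)
Lemma star_restriction_linear (s : cone_type F) f (g : ppoly (star s)) :
  pp_hom 1 f -> pp_hom 1 g -> star_restriction (cls f) (cls g) ->
  exists L : 'Hom(V, R^o), forall S v u, S \in cones F -> (val s \subset S)%B ->
    poshull (@gen _ _ F) S (val v) -> val u = starpi s (val v) ->
    f v = g u + L (val v).
Proof.
move=> fh gh /star_restrictionP[f1 [g1 [h [/cls_eq fI /cls_eq gI hI fg]]]].
have [La LaP] := lin_ideal_linear_part fI.
have [L1 L1P] := lin_ideal_linear_part hI.
have [Lb LbP] := lin_ideal_linear_part gI.
(* The linear parts of f - f1, of g - g1 pulled back to [V], and of h = f1 - g1. *)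
exists (La - (Lb \o starpi s)%VF + L1) => S v u Sc sS vS uv.
have [Pa Pa1 PaE] := LaP v; have [P1 P11 P1E] := L1P v; have [Pb Pb1 PbE] := LbP u.
have : (f v - g u) *: 'X = Pa - Pb + P1.
  apply: poly_eq_nat => n; rewrite hornerZ hornerX !hornerD hornerN.
  have [v' v'E] := supportTZ v (ler0n R n); have [u' u'E] := supportTZ u (ler0n R n).
  rewrite -(PaE n v') // -(PbE n u') // -(P1E n v') //.
  have := fg S v' u' Sc sS.
  rewrite u'E v'E uv linearZ /= => /(_ _ erefl) fg'.
  rewrite -[RHS]/(f v' - f1 v' - (g u' - g1 u') + h v') fg' => [|]; last first.
    case: vS => a a0 va; exists (fun i => n%:R * a i) => [i|]; first by rewrite mulr_ge0.
    by rewrite va scaler_sumr; apply: eq_bigr => i _; rewrite scalerA.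
  rewrite (pp_hom1Z fh _ v'E) // (pp_hom1Z gh _ u'E) //; ring.
move=> /(congr1 (fun P : {poly R} => P`_1)).
rewrite coefZ coefX mulr1 !coefD coefN Pa1 Pb1 P11.
rewrite !add_lfunE opp_lfunE comp_lfunE -uv => /(canRL (subrK _)) ->.
by rewrite addrC.
Qed.

Lemma positive_pl (c : ray F -> R) : (forall i, 0 < c i) -> positive (pl c).
Proof.
move=> c0 x; have [S [a [Sc a0 xa]]] := supportTP x => x0.
rewrite -[pl c x]/(pl_fun c x) (pl_funE _ Sc a0 xa) lt_def sumr_ge0 ?andbT => [|i _]; last first.
  by rewrite mulr_ge0 // ltW.
apply: contra x0; rewrite psumr_eq0 => [/allP a_0|i _]; last by rewrite mulr_ge0 // ltW.
rewrite xa big1 // => i iS; have := a_0 i (mem_index_enum _).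
by rewrite iS mulf_eq0 (gt_eqF (c0 i)) orbF => /eqP ->; rewrite scale0r.
Qed.

Lemma gen_poshull S (i : ray F) : i \in S -> poshull (@gen _ _ F) S (gen i).
Proof.
move=> iS; apply: (@poshull_subset _ _ _ [set i]%SET); first by rewrite finset.sub1set.
by exists (fun=> 1) => //; rewrite big_set1 scale1r.
Qed.

Lemma starpi_support (s : cone_type F) S (v : V) : S \in cones F ->
  (val s \subset S)%B -> poshull (@gen _ _ F) S v ->
  exists u : supportT (star s), val u = starpi s v.
Proof.
move=> Sc sS vS; have [cutc uS] := starpi_poshull Sc sS vS.
have us : starpi s v \in Defs.support (star s) by apply/mem_set; exists (star_cut s S).
by exists (SigSub us).
Qed.

(** The star of the zero cone is a copy of [F], so ampleness there gives a positive representative;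
    the coefficients are its values at the generators. *)
Lemma ample_divisors (l : chow F) : ample_cone l ->
  exists2 c : ray F -> R, (forall i, 0 < c i) & l = \sum_i c i *: divisor i.
Proof.
case=> -[f fh ->]; pose s : cone_type F := Sub finset.set0 (cones0 F).
move=> /(_ s)[g [gh gp /(star_restriction_linear fh gh)[L LE]]].
exists (fun i => f (gen_pt i) - L (gen i)); last first.
  under eq_bigr do rewrite scalerBl.
  by rewrite sumrB divisor_linear subr0 -pp_hom1_cls.
move=> i; have sS : (val s \subset [set i])%SET%B by exact: finset.sub0set.
have iS : poshull (@gen _ _ F) [set i]%SET (gen i) by apply: gen_poshull; rewrite inE.
have [u uE] := starpi_support (cones1 i) sS iS.
rewrite (LE _ (gen_pt i) u (cones1 i)) //= addrK; apply: gp; rewrite uE.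
have iP : (i \notin val s) && ((i |: val s)%SET \in cones F).
  by rewrite finset.in_set0 finset.setU0 cones1.
exact: (starpi_gen_neq0 (Sub i iP)).
Qed.

Lemma lfun_factor (W : vectType R) (p : 'Hom(V, W)) (L : 'Hom(V, R^o)) :
  limg p = fullv -> (lker p <= lker L)%VS ->
  exists L' : 'Hom(W, R^o), forall x, L x = L' (p x).
Proof.
move=> pf /subvP kL; exists (L \o p^-1)%VF => x; rewrite comp_lfunE /=.
apply/eqP; rewrite -subr_eq0 -linearB -memv_ker kL // memv_ker linearB /=.
by rewrite limg_lfunVK ?subrr // memv_img // memvf.
Qed.

Lemma star_join_setU1 (s : cone_type F) (j : star_ray s) (T : {set star_ray s}) :
  star_join (j |: T)%SET = (val j |: star_join T)%SET.
Proof. by rewrite /star_join imsetU1 finset.setUA. Qed.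

End Ample.

(** * Stars of stars and ampleness of restrictions *)

Section StarOfStar.
Variables (R : realType) (V : vectType R) (F : fan V).
Variables (s : cone_type F) (s1 : cone_type (star s)).

Lemma star_join_cone : star_join (val s1) \in cones F.
Proof. by have := valP s1; rewrite inE. Qed.

(** The star of [s1] in the star of [s] is the star of this cone of [F], up to the canonical
    isomorphism of iterated quotients. *)
Definition join_cone : cone_type F := Sub (star_join (val s1)) star_join_cone.

Lemma star_star_ray_subproof (j : star_ray s1) :
  (val (val j) \notin val join_cone) && ((val (val j) |: val join_cone)%SET \in cones F).
Proof.
have /andP[js1 jc] := valP j.
by rewrite mem_star_join js1 -star_join_setU1; rewrite inE in jc.
Qed.

Definition star_star_ray (j : star_ray s1) : star_ray join_cone :=
  Sub (val (val j)) (star_star_ray_subproof j).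

End StarOfStar.

(** Ampleness on the star of [s] at [s1] comes from ampleness on [F] at the joined cone [s2]. There
    the class is represented by a positive [g2], and [g] differs from [g2] by a linear function
    descending to the star of [s]. Values at the rays carry positivity over to the star of [s1], so
    no isomorphism of stars has to be built. *)
Lemma ample_star (R : realType) (V : vectType R) (F : fan V) (s : cone_type F)
    (l : chow F) : ample_cone l ->
  exists2 y, star_restriction (s := s) l y & ample_cone y.
Proof.
case=> -[f fh ->] fa; have [g [gh gp fg]] := fa s.
exists (cls g) => //; split=> [|s1]; first by exists g.
have [L LE] := star_restriction_linear fh gh fg.
pose s2 := join_cone s1.
have [g2 [g2h g2p /(star_restriction_linear fh g2h)[L2 L2E]]] := fa s2.
have s_s2 : (val s \subset val s2)%B by exact: finset.subsetUr.
have gE S (v : supportT F) u u2 : S \in cones F -> (val s2 \subset S)%B ->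
    poshull (@gen _ _ F) S (val v) -> val u = starpi s (val v) ->
    val u2 = starpi s2 (val v) -> g u = g2 u2 + (L2 - L) (val v).
  move=> Sc sS vS uv u2v; have := LE S v u Sc (fintype.subset_trans s_s2 sS) vS uv.
  rewrite (L2E S v u2) // add_lfunE opp_lfunE addrA => ->.
  by rewrite addrK.
(* Each generator of [s] maps to the origin of both stars, where [g] and [g2] vanish; so [L2 - L]
   kills the span of [s]. *)
have [L' L'E] : exists L' : 'Hom(starV s, R^o), forall x, (L2 - L) x = L' (starpi s x).
  apply: lfun_factor; first exact: limg_quotpi.
  rewrite lker_quotpi; apply/span_subvP => _ /mapP[i + ->]; rewrite mem_enum => is_.
  have is2 : i \in val s2 by exact: (fintype.subsetP s_s2).
  have := gE (val s2) (gen_pt i) (point : supportT (star s))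
    (point : supportT (star s2)) (valP s2) (fintype.subxx _) (gen_poshull is2).
  rewrite !starpi_gen0 // => /(_ erefl erefl).
  rewrite !pp_hom1_0 // add0r => /esym h; rewrite memv_ker; exact/eqP.
have [k kP] := star_genE s; have [k1 k1P] := star_genE s1.
have gL T j u2 : T \in cones (star s) -> (val s1 \subset T)%B -> j \in T ->
    val u2 = starpi s2 (gen (val j)) ->
    g (gen_pt (F := star s) j) - L' (gen (f := star s) j) = k j * g2 u2.
  rewrite inE => Tc sT jT u2E.
  have jS : poshull (@gen _ _ F) (star_join T) (gen (val j)).
    by apply: gen_poshull; rewrite mem_star_join.
  have sS : (val s2 \subset star_join T)%B by rewrite finset.setSU // imsetS.
  have [u uE] := starpi_support Tc (finset.subsetUr _ _ : (val s \subset _)%B) jS.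
  have jE : gen (f := star s) j = k j *: starpi s (gen (val j)) := (kP j).2.
  rewrite (pp_hom1Z (x := u) (t := k j) gh) ?uE ?jE //; last by rewrite ltW // (kP j).1.
  rewrite linearZ /= -L'E (gE _ (gen_pt (val j)) u u2 Tc sS) // -mulrBr.
  by rewrite addrK.
have k0 j : 0 < k j := (kP j).1; have k10 j : 0 < k1 j := (k1P j).1.
(* The values of [g - L'], rescaled by [k1] to the primitive generators of the star of [s1]. *)
pose c (j : star_ray s1) := k1 j *
  (g (gen_pt (F := star s) (val j)) - L' (gen (f := star s) (val j))).
exists (pl (F := star s1) c); split; first exact: pl_hom.
  apply: positive_pl => j.
  have /andP[_ jT] := valP j.
  have Tc : star_join (val j |: val s1)%SET \in cones F by move: jT; rewrite inE.
  have [u2 u2E] : exists u2 : supportT (star s2), val u2 = starpi s2 (gen (val (val j))).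
    apply: (starpi_support Tc); first by rewrite finset.setSU // imsetS // finset.subsetUr.
    by apply: gen_poshull; rewrite mem_star_join !inE eqxx.
  rewrite /c (gL (val j |: val s1)%SET (val j) u2) // ?finset.subsetUr ?finset.setU11 //.
  rewrite !mulr_gt0 //; apply: g2p; rewrite u2E.
  exact: (starpi_gen_neq0 (star_star_ray j)).
apply/star_restrictionP; exists g, (pl (F := star s1) c), (pp_lin (star s) L').
split=> //; first by rewrite -[pp_lin _ _]mulr1; exact: lin_ideal_lin.
move=> T w u1 Tc sT [b b0 wb] u1w.
have ch : pp_hom 1 (pl (F := star s1) c) by exact: pl_hom.
rewrite (star_hom1E k1P ch Tc sT b0 wb u1w) -[pp_lin _ _ w]/(L' (val w) : R).
apply/eqP; rewrite -subr_eq; apply/eqP.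
rewrite (pp_hom1E gh Tc b0 wb) wb linear_sum -sumrB.
rewrite (eq_bigr (fun j => b j * (g (gen_pt (F := star s) j) - L' (gen (f := star s) j))));
  last by move=> j _; rewrite linearZ mulrBr.
rewrite -{1}(star_cutK Tc sT) big_star_join.
(* The rays of [s1] map to the origin of the star of [s2], so [g - L'] vanishes on them. *)
have -> : \sum_(j in val s1) b j *
    (g (gen_pt (F := star s) j) - L' (gen (f := star s) j)) = 0.
  apply: big1 => j js.
  rewrite (gL (val s1) j (point : supportT (star s2))) ?(valP s1) // ?pp_hom1_0 ?mulr0 //.
  by rewrite starpi_gen0 //= mem_star_join.
rewrite Monoid.mulm1; apply: eq_bigr => j _; rewrite pl_gen /c mulrA divfK //.
by rewrite gt_eqF.
Qed.

(** * Degree maps *)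

Section Degree.
Variables (R : realType).

Lemma fan_dim_attained (V : vectType R) (F : fan V) :
  exists2 S, S \in cones F & #|S| = fan_dim F.
Proof.
have c0 : (0 < #|cones F|)%N by apply/card_gt0P; exists finset.set0; exact: cones0.
by have [S Sc SE] := eq_bigmax_cond (fun S : {set ray F} => #|S|) c0; exists S.
Qed.

Lemma deg_cone_gt0 (V : vectType R) (F : fan V) d w (deg : {scalar chow F}) S :
  fundamental_weight d w -> degree_map d w deg -> S \in cones F -> #|S| = d ->
  0 < deg (\prod_(i in S) divisor i).
Proof.
move=> [_ w0 _] dw Sc Sd; have := w0 S Sc Sd; rewrite -(dw S Sc Sd).
(* A zero value of [mult S] would force [w S = 0], so the positivity of the weight excludes it. *)
by case: (mult S) => [|n]; rewrite ?mulr0n ?ltxx // pmulrn_lgt0.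
Qed.

Lemma chow_deg_cone (V : vectType R) (F : fan V) (S : {set ray F}) :
  chow_deg #|S| (\prod_(i in S) divisor i).
Proof.
rewrite -big_enum -(big_map (@divisor _ _ F) xpredT id) cardE -(size_map (@divisor _ _ F)).
by apply: chow_deg_prod => _ /mapP[i _ ->]; exact: chow_deg_divisor.
Qed.

Lemma degZ (V : vectType R) (F : fan V) (deg : {scalar chow F}) c x :
  deg (c *: x) = c * deg x.
Proof. exact: linearZ. Qed.

(* The degree map is unique up to a positive scalar, so the properties of the
   one provided by [lefschetz] pass to every other one. *)
Lemma lefschetz_degree (V : vectType R) (F : fan V) d w (deg : {scalar chow F}) :
  lefschetz F d -> fundamental_weight d w -> degree_map d w deg ->
  [/\ fan_dim F = d,
      forall x, chow_deg d x -> deg x = 0 -> x = 0,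
      hodge_riemann d deg &
      forall t : cone_type F, (0 < #|val t|)%N -> lefschetz (star t) (d - #|val t|)].
Proof.
case=> w0 deg0 Fd fw0 dw0 pd _ hr st fw dw.
have [S Sc] := fan_dim_attained F; rewrite Fd => Sd.
have X0 := deg_cone_gt0 fw0 dw0 Sc Sd; have X1 := deg_cone_gt0 fw dw Sc Sd.
set X := \prod_(i in S) divisor i in X0 X1.
have Xd : chow_deg d X by rewrite -Sd; exact: chow_deg_cone.
pose k := deg X / deg0 X.
have k0 : 0 < k by rewrite divr_gt0.
(* The top degree piece is the line of [X], because [deg0] detects zero there. *)
have degE x : chow_deg d x -> deg x = k * deg0 x.
  move=> xd; have : x - (deg0 x / deg0 X) *: X = 0.
    apply: (poincare_top pd); first by apply: chow_degB => //; exact: chow_degZ.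
    by rewrite linearB /= degZ divfK ?subrr // gt_eqF.
  move/eqP; rewrite subr_eq0 => /eqP {1}->; rewrite degZ /k; field.
  by rewrite gt_eqF.
split=> // [x xd|j l x jd la xj lx x0].
  rewrite degE // => /eqP; rewrite mulf_eq0 gt_eqF //= => /eqP.
  exact: poincare_top pd xd.
have ld n : chow_deg n (l ^+ n).
  elim: n => [|n IH]; first by rewrite expr0; exact: chow_deg_1.
  by rewrite exprS -add1n; apply: chow_degM => //; case: la.
rewrite degE; last first.
  have -> : d = (d - 2 * j + j + j)%N by lia.
  by rewrite {2}(_ : d - 2 * j + j + j = d)%N; [do 2 apply: chow_degM => //|lia].
by rewrite mulrCA mulr_gt0 //; exact: hr.
Qed.

Section RayDegree.
Variables (V : vectType R) (F : fan V) (d : nat) (w : {set ray F} -> R).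
Variables (deg : {scalar chow F}).
Hypotheses (lefF : lefschetz F d.+1) (fw : fundamental_weight d.+1 w).
Hypothesis (dw : degree_map d.+1 w deg).

Lemma lefschetz_ray (i : ray F) : lefschetz (star (ray_cone i)) d.
Proof.
have [_ _ _ st] := lefschetz_degree lefF fw dw.
by have := st (ray_cone i); rewrite /= cards1 subSS subn0; apply.
Qed.

(** A projection formula. By [divisor_star0] the left side depends only on [y], which lies in a
    line; it suffices to compare both sides on the monomial of one maximal cone, where both are
    positive. *)
Lemma deg_ray (i : ray F) w1 (deg1 : {scalar chow (star (ray_cone i))}) :
  fundamental_weight d w1 -> degree_map d w1 deg1 ->
  exists2 k : R, 0 < k & forall x y, star_restriction x y -> chow_deg d y ->
    deg (divisor i * x) = k * deg1 y.
Proof.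
move=> fw1 dw1; set s := ray_cone i.
have [s1d top1 _ _] := lefschetz_degree (lefschetz_ray i) fw1 dw1.
have [c cP] := star_genE s.
have [S Sc] := fan_dim_attained (star s); rewrite s1d => Sd.
pose x0 : chow F := \prod_(j in S) divisor (val j).
pose y0 : chow (star s) := \prod_(j in S) (c j *: divisor (F := star s) j).
have xy0 : star_restriction x0 y0.
  by apply: star_restriction_prod => j _; exact: star_restriction_divisor.
have y0d : chow_deg d y0.
  rewrite /y0 -Sd -big_enum -(big_map (fun j => c j *: divisor (F := star s) j) xpredT id) cardE.
  rewrite -(size_map (fun j => c j *: divisor (F := star s) j)); apply: chow_deg_prod.
  by move=> _ /mapP[j _ ->]; apply: chow_degZ; exact: chow_deg_divisor.
have y0_gt0 : 0 < deg1 y0.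
  have -> : y0 = (\prod_(j in S) c j) *: \prod_(j in S) divisor (F := star s) j.
    rewrite /y0; apply: (big_rec3 (fun a b e => a = b *: e)); first by rewrite scale1r.
    by move=> j a b e _ ->; rewrite -scalerAl chow_scaleAr scalerA.
  rewrite degZ mulr_gt0 //; first by apply: prodr_gt0 => j _; rewrite (cP j).1.
  exact: (deg_cone_gt0 fw1 dw1 Sc Sd).
have x0_gt0 : 0 < deg (divisor i * x0).
  have -> : divisor i * x0 = \prod_(j in star_join S) divisor j.
    by rewrite big_star_join /= big_set1 mulrC.
  apply: (deg_cone_gt0 fw dw); first by move: Sc; rewrite inE.
  rewrite -sum1_card big_star_join /= !sum1_card cards1 addn1.
  by rewrite -Sd.
exists (deg (divisor i * x0) / deg1 y0); first by rewrite divr_gt0.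
move=> x y xy yd; pose t := deg1 y / deg1 y0.
have y_0 : y + (- t) *: y0 = 0.
  apply: top1; first by apply: chow_degD => //; exact: chow_degZ.
  by rewrite linearD /= degZ mulNr divfK ?subrr // gt_eqF.
have : divisor i * (x + (- t) *: x0) = 0.
  apply: divisor_star0; rewrite -y_0; apply: star_restrictionD => //.
  exact: star_restrictionZ.
move=> /(congr1 deg); rewrite mulrDr chow_scaleAr linearD /= degZ linear0 mulNr.
move=> /eqP; rewrite subr_eq0 => /eqP ->; rewrite /t; field.
by rewrite gt_eqF.
Qed.

End RayDegree.

(** * Positivity of degrees of products of ample and ray classes *)

Lemma ample_star_seq (V : vectType R) (F : fan V) (s : cone_type F) (l : seq (chow F)) :
  {in l, forall x, ample_cone x} -> exists l' : seq (chow (star s)),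
    [/\ size l' = size l, {in l', forall x, ample_cone x} &
        star_restriction (\prod_(x <- l) x) (\prod_(x <- l') x)].
Proof.
elim: l => [|x l IH] la.
  by exists [::]; split; rewrite // !big_nil; exact: star_restriction1.
have [|l' [l'l l'a ll']] := IH; first by move=> y yl; apply: la; rewrite inE yl orbT.
have [x' xx' x'a] := ample_star s (la x (mem_head _ _)).
exists (x' :: l'); split; first by rewrite /= l'l.
  by move=> y; rewrite inE => /orP[/eqP ->|/l'a].
by rewrite !big_cons; exact: star_restrictionM.
Qed.

Lemma ample_deg1 (V : vectType R) (F : fan V) (x : chow F) : ample_cone x -> chow_deg 1 x.
Proof. by case. Qed.

Lemma chow_deg_ample (V : vectType R) (F : fan V) (l : seq (chow F)) n :
  size l = n -> {in l, forall x, ample_cone x} -> chow_deg n (\prod_(x <- l) x).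
Proof. by move=> <- la; apply: chow_deg_prod => x /la/ample_deg1. Qed.

(** Induction on the dimension: one factor is a positive combination of ray classes, and the term of
    each ray is a positive multiple of a degree on its star. *)
Lemma deg_ample_gt0 d (V : vectType R) (F : fan V) w (deg : {scalar chow F}) :
  lefschetz F d -> fundamental_weight d w -> degree_map d w deg ->
  forall l, size l = d -> {in l, forall x, ample_cone x} -> 0 < deg (\prod_(x <- l) x).
Proof.
elim: d V F w deg => [|d IH] V F w deg lefF fw dw l ld la.
  case: l ld {la} => // _; rewrite big_nil.
  by have := deg_cone_gt0 fw dw (cones0 F) (cards0 _); rewrite finset.big_set0.
case: l ld la => // x l [ld] la; rewrite big_cons.
have [c c0 ->] := ample_divisors (la x (mem_head _ _)).
have ray_gt0 i : 0 < deg (divisor i * \prod_(x <- l) x).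
  have [w1 deg1 _ fw1 dw1 _ _ _ _] := lefschetz_ray lefF fw dw i.
  have [k k0 kE] := deg_ray lefF fw dw fw1 dw1.
  have [|l' [l'l l'a ll']] := @ample_star_seq _ F (ray_cone i) l.
    by move=> y yl; apply: la; rewrite inE yl orbT.
  rewrite (kE _ _ ll'); last by apply: chow_deg_ample => //; rewrite l'l.
  rewrite mulr_gt0 //; apply: (IH _ _ w1) => //; [exact: lefschetz_ray lefF fw dw i|by rewrite l'l].
have [Fd _ _ _] := lefschetz_degree lefF fw dw.
(* A cone of positive dimension supplies a ray, so the sum is not empty. *)
have [S Sc] := fan_dim_attained F; rewrite Fd => Sd.
have [i0 iS] : exists i, i \in S by apply/card_gt0P; rewrite Sd.
rewrite mulr_suml linear_sum /= (bigD1 i0) //= ltr_pwDl //.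
  by rewrite -scalerAl degZ mulr_gt0.
by apply: sumr_ge0 => i _; rewrite -scalerAl degZ mulr_ge0 // ltW.
Qed.

Section RayPositivity.
Variables (V : vectType R) (F : fan V) (w : {set ray F} -> R) (deg : {scalar chow F}).

Lemma deg_divisor_ample_gt0 d i l :
  lefschetz F d.+1 -> fundamental_weight d.+1 w -> degree_map d.+1 w deg ->
  size l = d -> {in l, forall x, ample_cone x} -> 0 < deg (divisor i * \prod_(x <- l) x).
Proof.
move=> lefF fw dw ld la.
have [w1 deg1 _ fw1 dw1 _ _ _ _] := lefschetz_ray lefF fw dw i.
have [k k0 kE] := deg_ray lefF fw dw fw1 dw1.
have [l' [l'l l'a ll']] := @ample_star_seq _ F (ray_cone i) l la.
rewrite (kE _ _ ll'); last by apply: chow_deg_ample => //; rewrite l'l.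
rewrite mulr_gt0 //; apply: (deg_ample_gt0 _ fw1 dw1) => //; last by rewrite l'l.
exact: (lefschetz_ray lefF fw dw i).
Qed.

End RayPositivity.

(** These degrees are the entries of the Bochner matrix along the edges of its graph; on the star of
    [i] the class of [j] becomes a positive multiple of a ray class. *)
Lemma deg_divisor2_ample_gt0 d (V : vectType R) (F : fan V) w (deg : {scalar chow F}) i j l :
  lefschetz F d.+2 -> fundamental_weight d.+2 w -> degree_map d.+2 w deg ->
  i != j -> [set i; j]%SET \in cones F ->
  size l = d -> {in l, forall x, ample_cone x} ->
  0 < deg (divisor i * (divisor j * \prod_(x <- l) x)).
Proof.
move=> lefF fw dw ij ijc ld la.
have lef1 := lefschetz_ray lefF fw dw i.
have [w1 deg1 _ fw1 dw1 _ _ _ _] := lef1.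
have [k k0 kE] := deg_ray lefF fw dw fw1 dw1.
have [l' [l'l l'a ll']] := @ample_star_seq _ F (ray_cone i) l la.
have [c cP] := star_genE (ray_cone i).
have jP : (j \notin val (ray_cone i)) && ((j |: val (ray_cone i))%SET \in cones F).
  by rewrite inE eq_sym ij finset.setUC.
have jj := star_restriction_divisor cP (Sub j jP).
rewrite (kE _ _ (star_restrictionM jj ll')); last first.
  rewrite -add1n; apply: chow_degM; last by apply: chow_deg_ample => //; rewrite l'l.
  by apply: chow_degZ; exact: chow_deg_divisor.
rewrite mulr_gt0 // -scalerAl degZ mulr_gt0 ?(cP _).1 //.
by apply: (deg_divisor_ample_gt0 _ lef1 fw1 dw1) => //; rewrite l'l.
Qed.

End Degree.

(** * The Hodge index inequality *)

Section HodgeIndex.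
Variables (R : realType).

(** The combination [u] of [y] and [z] annihilated by [m ^+ d.+1] satisfies deg(m^d u u) = b^2 a +
    a^2 b > 0, because the cross terms vanish. This contradicts the Hodge-Riemann relation in degree
    one. *)
Lemma effective_connected (V : vectType R) (F : fan V) d w (deg : {scalar chow F})
    (m y z : chow F) :
  lefschetz F d.+2 -> fundamental_weight d.+2 w -> degree_map d.+2 w deg ->
  ample_cone m -> m = y + z -> chow_deg 1 y -> chow_deg 1 z -> y * z = 0 ->
  0 < deg (y * m ^+ d.+1) -> 0 < deg (z * m ^+ d.+1) -> False.
Proof.
move=> lefF fw dw ma myz y1 z1 yz0; set a := deg _; set b := deg _ => a0 b0.
have [_ top hr _] := lefschetz_degree lefF fw dw.
have md n : chow_deg n (m ^+ n).
  elim: n => [|n IH]; first by rewrite expr0; exact: chow_deg_1.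
  by rewrite exprS -add1n; apply: chow_degM => //; case: ma.
pose u := b *: y - a *: z.
have u1 : chow_deg 1 u by apply: chow_degB; exact: chow_degZ.
have mu0 : m ^+ d.+1 * u = 0.
  apply: top; first by rewrite -addn1; exact: chow_degM.
  rewrite mulrBr !chow_scaleAr linearB /= !degZ ![m ^+ _ * _]mulrC -/a -/b.
  by rewrite mulrC subrr.
have uu : deg (m ^+ d * u * u) = b ^+ 2 * a + a ^+ 2 * b.
  have mE t t' : m = t + t' -> t * t' = 0 -> m ^+ d * (t * t) = t * m ^+ d.+1.
    move=> mt tt0; rewrite exprSr; set M := _ ^+ d.
    by rewrite mt [RHS]mulrCA mulrDr tt0 addr0.
  have -> : m ^+ d * u * u = b ^+ 2 *: (y * m ^+ d.+1) + a ^+ 2 *: (z * m ^+ d.+1).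
    have zy0 : z * y = 0 by rewrite mulrC.
    have mzy : m = z + y by rewrite addrC.
    rewrite -(mE _ _ myz yz0) -(mE _ _ mzy zy0).
    have -> : m ^+ d * u * u = m ^+ d * (b ^+ 2 *: (y * y) + a ^+ 2 *: (z * z)).
      rewrite -mulrA /u; congr (_ * _).
      rewrite mulrBl !mulrBr -!scalerAl !chow_scaleAr !scalerA yz0 zy0.
      by rewrite !scaler0 subr0 sub0r opprK !expr2.
    by rewrite mulrDr !chow_scaleAr.
  by rewrite linearD /= !degZ.
have := hr 1%N m u; rewrite !muln1 subn2 /= => /(_ isT ma u1 mu0) hru.
have uu0 : 0 < deg (m ^+ d * u * u).
  by rewrite uu addr_gt0 // mulr_gt0 // exprn_gt0.
have [u0|/hru] := eqVneq u 0; first by rewrite u0 mulr0 linear0 ltxx in uu0.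
by rewrite expr1 mulN1r oppr_gt0 ltNge ltW.
Qed.

Section Bilinear.
Variables (V : vectType R) (F : fan V) (deg : {scalar chow F}) (n : nat).
Variables (X : 'I_n -> chow F) (Q : chow F).

Lemma deg_sumE (a : chow F) (z : 'I_n -> R) :
  deg (a * (\sum_k z k *: X k) * Q) = \sum_k deg (a * X k * Q) * z k.
Proof.
rewrite mulr_sumr mulr_suml linear_sum; apply: eq_bigr => k _ /=.
by rewrite chow_scaleAr -scalerAl degZ mulrC.
Qed.

Lemma deg_sum2E (z : 'I_n -> R) :
  deg ((\sum_k z k *: X k) * (\sum_k z k *: X k) * Q) =
  \sum_i \sum_j deg (X i * X j * Q) * (z i * z j).
Proof.
rewrite deg_sumE; apply: eq_bigr => i _; rewrite [_ * X i]mulrC deg_sumE mulr_suml.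
by apply: eq_bigr => j _; rewrite -mulrA [z i * _]mulrC.
Qed.

End Bilinear.

Lemma big_ray (V : vectType R) (F : fan V) (T : nmodType) (f : ray F -> T) :
  \sum_i f i = \sum_(k < #|ray F|) f (enum_val k).
Proof. exact: (reindex _ (onW_bij _ (@enum_val_bij (ray F)))). Qed.

(** An arbitrary function [deg] is allowed so that multiplication by a ray class can be built into
    it. *)
Definition hodge_index_property (V : vectType R) (F : fan V) d (deg : chow F -> R) :=
  forall (l : seq (chow F)) b x, size l = d -> {in l, forall y, ample_cone y} ->
    ample_cone b -> chow_deg 1 x ->
    deg (x * x * \prod_(y <- l) y) * deg (b * b * \prod_(y <- l) y)
    <= deg (x * b * \prod_(y <- l) y) ^+ 2.

(** Semidefiniteness on the orthogonal of a single ample [m] gives the inequality for every ample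
    [b]: the form is tested at the combination of [b] and [x] orthogonal to [m]. *)
Lemma hodge_index_of_semidefinite (V : vectType R) (F : fan V) d w (deg : {scalar chow F})
    (l : seq (chow F)) m b x :
  lefschetz F d.+2 -> fundamental_weight d.+2 w -> degree_map d.+2 w deg ->
  size l = d -> {in l, forall y, ample_cone y} -> ample_cone m ->
  (forall y, chow_deg 1 y -> deg (y * m * \prod_(z <- l) z) = 0 ->
    deg (y * y * \prod_(z <- l) z) <= 0) ->
  ample_cone b -> chow_deg 1 x ->
  deg (x * x * \prod_(y <- l) y) * deg (b * b * \prod_(y <- l) y)
    <= deg (x * b * \prod_(y <- l) y) ^+ 2.
Proof.
move=> lefF fw dw ld la ma semi ba x1.
have pos a c : ample_cone a -> ample_cone c -> 0 < deg (a * c * \prod_(y <- l) y).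
  move=> aa ca; have := deg_ample_gt0 lefF fw dw (l := [:: a, c & l]).
  rewrite /= ld !big_cons mulrA; apply=> // y.
  by rewrite !inE => /or3P[/eqP->|/eqP->|/la].
set P := \prod_(y <- l) y in semi pos *.
pose qm := deg (x * m * P); pose qb := deg (b * m * P).
apply: (@hyperbolic_reverse_CS _ _ _ _ qm qb); [exact: pos|exact/ltW/pos|].
have := semi (qm *: b - qb *: x).
have -> : deg ((qm *: b - qb *: x) * m * P) = 0.
  by rewrite !mulrBl -!scalerAl linearB /= !degZ -/qm -/qb mulrC subrr.
have -> : deg ((qm *: b - qb *: x) * (qm *: b - qb *: x) * P) =
    qm ^+ 2 * deg (b * b * P) - 2 * qm * qb * deg (x * b * P) + qb ^+ 2 * deg (x * x * P).
  have -> : (qm *: b - qb *: x) * (qm *: b - qb *: x) * P =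
      (qm * qm) *: (b * b * P) - (qm * qb) *: (x * b * P) -
      ((qm * qb) *: (x * b * P) - (qb * qb) *: (x * x * P)).
    rewrite mulrBl !mulrBr !mulrBl -!scalerAl !chow_scaleAr -!scalerAl !scalerA.
    by rewrite [b * x]mulrC [qb * qm]mulrC.
  by rewrite !linearB /= !degZ; ring.
apply=> //; apply: chow_degB; apply: chow_degZ => //; exact: ample_deg1.
Qed.

(** Passing to the star multiplies every degree by the same constant [k], hence both sides by its
    square. *)
Lemma hodge_index_ray (V : vectType R) (F : fan V) d w (deg : {scalar chow F}) i :
  (forall V (F : fan V) w (deg : {scalar chow F}), lefschetz F d.+2 ->
     fundamental_weight d.+2 w -> degree_map d.+2 w deg -> hodge_index_property d deg) ->
  lefschetz F d.+3 -> fundamental_weight d.+3 w -> degree_map d.+3 w deg ->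
  hodge_index_property d (fun y : chow F => deg (divisor i * y)).
Proof.
move=> IH lefF fw dw l b x ld la ba x1.
have lef1 := lefschetz_ray lefF fw dw i.
have [w1 deg1 _ fw1 dw1 _ _ _ _] := lef1.
have [k k0 kE] := deg_ray lefF fw dw fw1 dw1.
have [l' [l'l l'a ll']] := @ample_star_seq _ _ F (ray_cone i) l la.
have [b' bb' b'a] := ample_star (ray_cone i) ba.
have [x' x'1 xx'] := star_restriction_exists i x1.
have eq2 (a c : chow F) (a' c' : chow (star (ray_cone i))) :
    star_restriction a a' -> star_restriction c c' -> chow_deg 1 a' -> chow_deg 1 c' ->
    deg (divisor i * (a * c * \prod_(y <- l) y)) = k * deg1 (a' * c' * \prod_(y <- l') y).
  move=> aa' cc' a1 c1; apply: kE; first by do 2 apply: star_restrictionM => //.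
  rewrite -add2n; apply: chow_degM; first by rewrite -[2%N]/(1 + 1)%N; apply: chow_degM.
  by apply: chow_deg_ample => //; rewrite l'l.
have b'1 := ample_deg1 b'a.
rewrite (eq2 _ _ x' x') // (eq2 _ _ b' b') // (eq2 _ _ x' b') // mulrACA exprMn -expr2.
rewrite ler_wpM2l ?sqr_ge0 //; apply: (IH _ _ w1) => //.
by rewrite l'l.
Qed.

(** The form is pulled back to coefficient vectors on the rays, where relations among the ray
    classes do no harm, and [bochner_hyperbolic] applies. *)
Lemma hodge_index_semidefinite (V : vectType R) (F : fan V) d w (deg : {scalar chow F}) l m :
  (forall V (F : fan V) w (deg : {scalar chow F}), lefschetz F d.+2 ->
     fundamental_weight d.+2 w -> degree_map d.+2 w deg -> hodge_index_property d deg) ->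
  lefschetz F d.+3 -> fundamental_weight d.+3 w -> degree_map d.+3 w deg ->
  size l = d -> {in l, forall y, ample_cone y} -> ample_cone m ->
  forall y, chow_deg 1 y -> deg (y * m * (m * \prod_(z <- l) z)) = 0 ->
    deg (y * y * (m * \prod_(z <- l) z)) <= 0.
Proof.
move=> IH lefF fw dw ld la ma y /chow_deg1P[z ->]; rewrite big_ray => ym0.
set P := \prod_(z <- l) z in ym0 *.
have [c c0 mE] := ample_divisors ma; rewrite big_ray in mE.
pose n := #|ray F|.
pose X (k : 'I_n) := divisor (F := F) (enum_val k).
pose C (k : 'I_n) := c (enum_val k).
have {}mE : m = \sum_k C k *: X k by [].
pose M i j := deg (X i * X j * (m * P)).
pose p i := deg (X i * m * (m * P)).
have p0 i : 0 < p i.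
  rewrite /p -mulrA; have := deg_divisor_ample_gt0 (enum_val i) lefF fw dw (l := [:: m, m & l]).
  rewrite /= ld !big_cons; apply=> // t.
  by rewrite !inE => /or3P[/eqP->|/eqP->|/la].
have p'E i : p i = deg (X i * (m * m * P)) by rewrite /p !mulrA.
have pE i : \sum_j M i j * C j = p i by rewrite /p {1}mE deg_sumE.
have M_adj i j : i != j -> [set enum_val i; enum_val j]%SET \in cones F -> 0 < M i j.
  move=> ij ijc; rewrite /M -mulrA.
  have := deg_divisor2_ample_gt0 (l := m :: l) lefF fw dw _ ijc.
  rewrite /= ld big_cons; apply=> //; first by rewrite (inj_eq enum_val_inj).
  by move=> t; rewrite inE => /predU1P[->|/la].
have M_nadj i j : [set enum_val i; enum_val j]%SET \notin cones F -> X i * X j = 0.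
  exact: divisorM0.
have bochner zz : \sum_i \sum_j M i j * (zz i * zz j) <=
    \sum_i C i / p i * (\sum_j M i j * zz j) ^+ 2.
  rewrite -deg_sum2E; set t := \sum_k zz k *: X k.
  have t1 : chow_deg 1 t.
    rewrite /t; apply/chow_deg1P; exists (fun i => zz (enum_rank i)).
    by rewrite big_ray; apply: eq_bigr => k _; rewrite enum_valK.
  (* The factor [m] of the form itself, not an argument of it, is expanded over the rays. *)
  have -> : deg (t * t * (m * P)) = \sum_i C i * deg (X i * (t * t * P)).
    rewrite mulrCA -[m]mul1r {1}mE deg_sumE.
    by apply: eq_bigr => i _; rewrite mul1r mulrC.
  apply: ler_sum => i _.
  have := hodge_index_ray (enum_val i) IH lefF fw dw ld la ma t1.
  rewrite -/P -/(X i) -p'E => h.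
  rewrite -deg_sumE -/t -[C i / p i * _]mulrA ler_wpM2l ?(ltW (c0 _)) //.
  rewrite [(p i)^-1 * _]mulrC ler_pdivlMr //; apply: le_trans h _.
  by rewrite le_eqVlt; apply/orP; left; apply/eqP; rewrite !mulrA.
rewrite deg_sum2E.
apply: (@bochner_hyperbolic _ _ M C p) => //.
- by move=> i j; rewrite /M [X i * _]mulrC.
- move=> i j ij.
  have [/M_adj|/M_nadj] := boolP ([set enum_val i; enum_val j]%SET \in cones F).
    by move=> /(_ ij)/ltW.
  by rewrite /M => ->; rewrite mul0r linear0.
- by move=> i; exact: c0.
- move=> A A0 Asep; apply/eqP; rewrite -finset.subTset; apply/fintype.subsetP => j _.
  apply: contraT => jA; exfalso.
  (* A separation of the graph would split [m] into two parts with zero product, each of positive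
     degree against powers of [m]. *)
  pose a := \sum_(k in A) C k *: X k; pose b := \sum_(k | k \notin A) C k *: X k.
  have part1 (B : pred 'I_n) : chow_deg 1 (\sum_(k | B k) C k *: X k).
    apply/chow_deg1P; exists (fun i => if B (enum_rank i) then C (enum_rank i) else 0).
    rewrite big_ray big_mkcond; apply: eq_bigr => k _; rewrite enum_valK.
    by case: ifP => // _; rewrite scale0r.
  have part0 (B : pred 'I_n) k0 : B k0 -> 0 < deg ((\sum_(k | B k) C k *: X k) * m ^+ d.+2).
    have Xm k : 0 < deg (X k * m ^+ d.+2).
      have := deg_divisor_ample_gt0 (enum_val k) lefF fw dw (l := nseq d.+2 m).
      rewrite size_nseq big_nseq iter_mulr_1; apply=> // t.
      by rewrite mem_nseq => /andP[_ /eqP ->].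
    move=> Bk; rewrite mulr_suml linear_sum (bigD1 k0) //= ltr_pwDl //.
      by rewrite -scalerAl degZ mulr_gt0 // c0.
    by apply: sumr_ge0 => k _; rewrite -scalerAl degZ mulr_ge0 // ltW // c0.
  have [k kA] := set0Pn _ A0.
  apply: (effective_connected lefF fw dw ma (y := a) (z := b)).
  + by rewrite mE (bigID (mem A)).
  + exact: part1.
  + exact: part1.
  + rewrite /a /b mulr_suml big1 // => k1 k1A; rewrite mulr_sumr big1 // => k2 k2A.
    rewrite -scalerAl chow_scaleAr M_nadj ?scaler0 //.
    have k12 : k1 != k2 by apply: contraNneq k2A => <-.
    by apply/negP => /(M_adj _ _ k12); rewrite Asep // ltxx.
  + exact: (part0 _ k).
  + exact: (part0 _ j).
- rewrite -[RHS]ym0 [X in _ = deg (X * _)]mulrC deg_sumE; apply: eq_bigr => i _.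
  by rewrite /p [X i * m]mulrC.
Qed.

Lemma hodge_index d (V : vectType R) (F : fan V) w (deg : {scalar chow F}) :
  lefschetz F d.+2 -> fundamental_weight d.+2 w -> degree_map d.+2 w deg ->
  hodge_index_property d deg.
Proof.
elim: d V F w deg => [|d IH] V F w deg lefF fw dw [|m l] b x // ld la ba x1.
  (* In dimension two [b] itself serves as [m]: its orthogonal is the primitive part, and
     Hodge-Riemann in degree one concludes. *)
  apply: (hodge_index_of_semidefinite lefF fw dw ld la ba) => // y y1.
  rewrite big_nil !mulr1 => yb0.
  have [_ top hr _] := lefschetz_degree lefF fw dw.
  have by0 : b ^+ 1 * y = 0.
    by rewrite expr1 mulrC; apply: top yb0; apply: (@chow_degM _ _ _ 1 1); last exact: ample_deg1.
  have [->|y0] := eqVneq y 0; first by rewrite mulr0 linear0.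
  have := hr 1%N b y isT ba y1 by0 y0.
  by rewrite expr0 mul1r expr1 mulN1r oppr_gt0 => /ltW.
have ma := la m (mem_head _ _).
apply: (hodge_index_of_semidefinite lefF fw dw ld la ma) => // y y1.
rewrite big_cons; apply: (hodge_index_semidefinite IH lefF fw dw) => //.
  by case: ld.
by move=> z zl; apply: la; rewrite inE zl orbT.
Qed.

End HodgeIndex.

(** * Passage to the closure *)

Section Closure.
Variables (R : realType) (V : vectType R) (F : fan V).
Implicit Types (c : 'rV[R]_#|ray F|).

(** Nonnegativity is a closed condition on the coordinate vectors, on which the closure is
    defined. *)
Lemma chow1_closure_ge0 (K : set (chow F)) (G : chow F -> R) y :
  continuous (G \o @chow1_vec R V F) -> (forall z, K z -> 0 <= G z) ->
  chow1_closure K y -> 0 <= G y.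
Proof.
move=> Gc KG [c cK <-].
have cl : closed ((G \o @chow1_vec R V F) @^-1` [set t | 0 <= t]).
  by apply: closed_comp (@closed_ge R 0) => t _; exact: Gc.
have sub : @chow1_vec R V F @^-1` K `<=` (G \o @chow1_vec R V F) @^-1` [set t | 0 <= t].
  by move=> t /KG.
by have := closure_subset sub cK; rewrite -(proj1 (closure_id _) cl).
Qed.

Lemma chow1_vecE c : chow1_vec c = \sum_i c 0 (enum_rank i) *: divisor i.
Proof. exact: pl_cls. Qed.

Lemma deg_linear_continuous (deg : {scalar chow F}) a :
  continuous (fun c => deg (a * chow1_vec c)).
Proof.
have -> : (fun c => deg (a * chow1_vec c)) =
    (fun c => \sum_i c 0 (enum_rank i) * deg (a * divisor i)).
  apply/funext => c; rewrite chow1_vecE mulr_sumr linear_sum; apply: eq_bigr => i _ /=.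
  by rewrite chow_scaleAr degZ.
apply: (continuous_big add_continuous) => i _ c.
exact: cvgM (@coord_continuous R _ _ 0 (enum_rank i) c) (cvg_cst _).
Qed.

Lemma deg_quadratic_continuous (deg : {scalar chow F}) a :
  continuous (fun c => deg (a * (chow1_vec c * chow1_vec c))).
Proof.
have -> : (fun c => deg (a * (chow1_vec c * chow1_vec c))) =
    (fun c => \sum_i c 0 (enum_rank i) * deg (a * divisor i * chow1_vec c)).
  apply/funext => c; rewrite {1}chow1_vecE mulr_suml mulr_sumr linear_sum.
  by apply: eq_bigr => i _ /=; rewrite -scalerAl chow_scaleAr degZ mulrA.
apply: (continuous_big add_continuous) => i _ c.
exact: cvgM (@coord_continuous R _ _ 0 (enum_rank i) c) (@deg_linear_continuous _ _ c).
Qed.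

(** Limits are taken in one class at a time. With the other classes fixed, a factor [z] of the first
    list is approximated by ample classes, which move to the second list; [b] is treated last, once
    the first list is empty. *)
Lemma hodge_index_closure d w (deg : {scalar chow F}) (l l' : seq (chow F)) b x :
  lefschetz F d.+2 -> fundamental_weight d.+2 w -> degree_map d.+2 w deg ->
  (size l + size l')%N = d ->
  {in l, forall y, chow1_closure (@ample_cone R V F) y} ->
  {in l', forall y, ample_cone y} ->
  chow1_closure (@ample_cone R V F) b -> chow_deg 1 x ->
  deg (x * x * (\prod_(y <- l) y * \prod_(y <- l') y)) *
    deg (b * b * (\prod_(y <- l) y * \prod_(y <- l') y))
  <= deg (x * b * (\prod_(y <- l) y * \prod_(y <- l') y)) ^+ 2.
Proof.
move=> lefF fw dw; elim: l l' => [|z l IH] l' ld lc la bc x1; rewrite -subr_ge0.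
  rewrite big_nil mul1r; set P := \prod_(y <- _) y.
  apply: (chow1_closure_ge0 (G := fun b => deg (x * b * P) ^+ 2 -
    deg (x * x * P) * deg (b * b * P)) _ _ bc) => [|{bc}b ba]; last first.
    by rewrite subr_ge0; apply: (hodge_index lefF fw dw).
  rewrite (_ : _ \o _ = (fun c => deg (x * P * chow1_vec c) * deg (x * P * chow1_vec c)
    - deg (x * x * P) * deg (P * (chow1_vec c * chow1_vec c)))); last first.
    by apply/funext => t /=; rewrite expr2 [x * _ * P]mulrAC [chow1_vec t * _ * P]mulrC.
  move=> c; have lin := @deg_linear_continuous deg (x * P) c.
  exact: cvgB (cvgM lin lin) (cvgM (cvg_cst _) (@deg_quadratic_continuous deg P c)).
rewrite big_cons; set P := \prod_(y <- l) y; set Q := \prod_(y <- _) y.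
have zc := lc z (mem_head _ _).
(* Isolating [t] shows each degree to be linear in it. *)
have EE y t : y * (t * P * Q) = y * (P * Q) * t by rewrite -!mulrA [t * _]mulrC -!mulrA.
apply: (chow1_closure_ge0 (G := fun t => deg (x * b * (t * P * Q)) ^+ 2 -
  deg (x * x * (t * P * Q)) * deg (b * b * (t * P * Q))) _ _ zc) => [|t ta]; last first.
  have := IH (t :: l'); rewrite big_cons -/P -/Q [P * (t * Q)]mulrCA mulrA subr_ge0.
  apply=> //.
  - by rewrite -ld /= addnS.
  - by move=> y yl; apply: lc; rewrite inE yl orbT.
  - by move=> y; rewrite inE => /predU1P[->|/la].
rewrite (_ : _ \o _ = (fun c =>
  deg (x * b * (P * Q) * chow1_vec c) * deg (x * b * (P * Q) * chow1_vec c)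
  - deg (x * x * (P * Q) * chow1_vec c) * deg (b * b * (P * Q) * chow1_vec c))).
  move=> c; have lin a := @deg_linear_continuous deg a c.
  exact: cvgB (cvgM (lin _) (lin _)) (cvgM (lin _) (lin _)).
by apply/funext => t /=; rewrite !EE expr2.
Qed.

End Closure.

Unset Implicit Arguments.

Theorem theorem5p28 (R : realType) (V : vectType R) (F : fan V) (d : nat)
    (hd : (2 <= d)%N) (hF : lefschetz F d)
    (w : {set ray F} -> R) (hw : fundamental_weight d w)
    (deg : {scalar chow F}) (hdeg : degree_map d w deg)
    (l : nat -> chow F) (hl1 : chow_deg 1 (l 1%N))
    (hl : forall i, (2 <= i <= d)%N -> chow1_closure (@ample_cone R V F) (l i)) :
  deg (\prod_(1 <= i < d.+1) l i) ^+ 2 >=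
  deg (l 1%N * l 1%N * \prod_(3 <= i < d.+1) l i) *
  deg (l 2%N * l 2%N * \prod_(3 <= i < d.+1) l i).
Proof.
case: d hd hF hw hdeg hl => [//|[//|d]] _ hF hw hdeg hl.
rewrite [\prod_(1 <= i < _) _]big_ltn // [\prod_(2 <= i < _) _]big_ltn // mulrA.
rewrite -!(big_map l xpredT id).
(* All factors from index 3 on go into the closure list, and the ample list is empty; [l 2] is the
   class [b] and [l 1] the free class [x]. *)
have := @hodge_index_closure R V F d w deg [seq l i | i <- index_iota 3 d.+3] [::] (l 2%N) (l 1%N).
rewrite big_nil mulr1; apply=> //; last by apply: hl; lia.
  by rewrite size_map size_iota addn0; lia.
by move=> _ /mapP[i + ->]; rewrite mem_index_iota => i3; apply: hl; lia.
Qed.
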